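(* For all $\ell,n\ge 1$, all middle orders on $\mathfrak S_n$ have the same number of complete chains of length $\ell$, which is equal to $$\sum_{k=0}^{\ell}(-1)^{\ell-k}\binom{\ell}{k}\prod_{i=0}^{n-1}\binom{k+i-1}{i}.$$
   Context: A middle order on $\mathfrak S_n$ is a partial order $\preceq$ on $\mathfrak S_n$ such that $(\mathfrak S_n,\preceq)$ is a distributive lattice and $v\le_R w\Rightarrow v\preceq w\Rightarrow v\le w$ for all $v,w$. Here $\le$ is the Bruhat order and $\le_R$ is the right weak order: writing permutations as words, $v\le_R w$ iff every pair of values $i<j$ with $j$ before $i$ in $v$ also has $j$ before $i$ in $w$. A chain $x_0<x_1<\dots<x_\ell$ has length $\ell$; a chain of a finite lattice is complete if it contains the minimum and the maximum of the lattice. By convention $\binom{a}{0}=1$ for every integer $a$ (including $a=-1$). *)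

(* Defs.v *)
From HB Require Import structures.
From mathcomp Require Import all_boot all_order all_fingroup all_algebra.

Set Implicit Arguments.
Unset Strict Implicit.
Unset Printing Implicit Defensive.

Import GroupScope.

(* The word of [v : 'S_n] is [v 0, v 1, ..., v (n - 1)], so the position of the *)
(* value [i] is [v^-1 i].                                                     *)
Definition before n (v : 'S_n) (i j : 'I_n) : bool := v^-1 i < v^-1 j.

Definition right_weak_le n (v w : 'S_n) : Prop :=
  forall i j : 'I_n, i < j -> before v j i -> before w j i.

Definition perm_length n (w : 'S_n) : nat :=
  #|[set p : 'I_n * 'I_n | (p.1 < p.2) && (w p.2 < w p.1)]|.

Definition bruhat_step n (v w : 'S_n) : bool :=
  [exists a : 'I_n, exists b : 'I_n, w == v * tperm a b]
  && (perm_length v < perm_length w).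

Definition bruhat_le n (v w : 'S_n) : bool := connect (@bruhat_step n) v w.

(* [r] is the order relation of some library distributive lattice structure   *)
(* with carrier [T] itself.                                                   *)
Definition distr_lattice_order (T : Type) (r : rel T) : Prop :=
  exists (d : Order.disp_t) (c : Order.DistrLattice d T),
    forall x y : T, r x y = @Order.le d (Order.DistrLattice.Pack c) x y.

Definition middle_order n (r : rel 'S_n) : Prop :=
  [/\ distr_lattice_order r,
      forall v w : 'S_n, right_weak_le v w -> r v w
    & forall v w : 'S_n, r v w -> bruhat_le v w].

Section Chains.

Variables (T : finType) (r : rel T).

Definition strict : rel T := [rel x y | (x != y) && r x y].

Definition is_minimum (x : T) : bool := [forall y, r x y].

Definition is_maximum (x : T) : bool := [forall y, r y x].

(* A chain x_0 < ... < x_l of length l is the tuple of its l + 1 elements in  *)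
(* increasing order.                                                          *)
Definition complete_chains (l : nat) : {set l.+1.-tuple T} :=
  [set c : l.+1.-tuple T |
    [&& sorted strict c, has is_minimum c & has is_maximum c]].

End Chains.

(* Main.v *)
Require Import Defs.
From HB Require Import structures.
From mathcomp Require Import all_boot all_order all_fingroup all_algebra.
From mathcomp Require Import zify ring.

(** A middle order is a finite distributive lattice on the words of
permutations; by Birkhoff, a word [w] is encoded by the set [f w] of
join-irreducibles below it.  The sandwich between the weak and the Bruhat order
makes [#|f w|] the number of inversions, so that an adjacent transposition of
[i < j] adds a single label to [f w].  Squares show that this label depends on
[i], [j] and the set of letters on their left; in a hexagon on [i < j < k] the
Bruhat order leaves two candidates for the join of the two lower elements, hence
two types of hexagon.  An analysis of four letters shows that the type of a
hexagon depends on the triple [i, j, k] only, and which types can occur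
together.  The triples [min < j < max] then split the letters into an initial
part L and a final part R in such a way that [v] is below [w] if and only if this
holds for their restrictions to L, for their restrictions to R, and for the two
lattice paths recording which positions hold a letter of L.

So the lattice is, recursively, a product whose factors are lattices of
partitions in a box.  The multichains of such a factor are plane partitions,
counted by MacMahon's formula (a determinant, obtained by reading the paths of a
multichain simultaneously letter by letter), and the product telescopes to the
number of multichains of a product of chains with 1, 2, ..., n elements.
Inclusion-exclusion turns multichains into chains. *)

Set Implicit Arguments.
Unset Strict Implicit.
Unset Printing Implicit Defensive.

(** * Chains and multichains *)

(** Joins in a middle order are known only as unions of sets; the task is to name the words that
    realize them. Besides the monotonicity of the length, the Bruhat order serves one purpose here:
    if a word lies one inversion above another one, the two differ by an exchange of two letters.
    When two words differ by a 3-cycle or by a double transposition of letters and their union has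
    only one more element, few words are an exchange away from both, and counting inversions selects
    among them.

    The hypotheses passed to the four-letter analysis ([middle_fun]) are self-dual under reversal of
    words, so that each argument on joins also yields one on meets. It therefore carries only what
    restricts to such words ([typed_fun]): labels, hexagons with a type for each triple, and the
    list of admissible types of four triples. *)

Section Multichains.

(* [mchains s r c y] counts the sequences [z_1, ..., z_c] of elements of [s]   *)
(* with [r y z_1], [r z_1 z_2], ...                                            *)
Fixpoint mchains (T : Type) (s : seq T) (r : rel T) (c : nat) (y : T) : nat :=
  if c is c'.+1 then \sum_(z <- s | r y z) mchains s r c' z else 1.

Definition all_mchains (T : Type) (s : seq T) (r : rel T) (c : nat) : nat :=
  if c is c'.+1 then \sum_(z <- s) mchains s r c' z else 1.

Lemma mchains_map (T U : eqType) (h : T -> U) (s : seq T) (r : rel T) (r' : rel U) c y :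
  y \in s -> {in s &, forall y z, r y z = r' (h y) (h z)} ->
  mchains [seq h z | z <- s] r' c (h y) = mchains s r c y.
Proof.
move=> sy rr'; elim: c y sy => //= c IHc y sy.
rewrite big_map big_seq_cond [RHS]big_seq_cond; apply: eq_big => z.
  by case sz: (z \in s) => //=; rewrite rr'.
by case/andP=> sz _; apply: IHc.
Qed.

Lemma all_mchains_map (T U : eqType) (h : T -> U) (s : seq T) (r : rel T) (r' : rel U) c :
  {in s &, forall y z, r y z = r' (h y) (h z)} ->
  all_mchains [seq h z | z <- s] r' c = all_mchains s r c.
Proof.
move=> rr'; case: c => //= c; rewrite big_map big_seq [RHS]big_seq.
by apply: eq_bigr => z sz; apply: mchains_map.
Qed.

Lemma mchains_perm (T : eqType) (s s' : seq T) (r : rel T) c y :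
  perm_eq s s' -> mchains s r c y = mchains s' r c y.
Proof.
move=> ss'; elim: c y => //= c IHc y.
by rewrite (perm_big _ ss'); apply: eq_bigr => z _; apply: IHc.
Qed.

Lemma all_mchains_perm (T : eqType) (s s' : seq T) (r : rel T) c :
  perm_eq s s' -> all_mchains s r c = all_mchains s' r c.
Proof.
move=> ss'; case: c => //= c.
by rewrite (perm_big _ ss'); apply: eq_bigr => z _; apply: mchains_perm.
Qed.

Definition prod_rel (T U : Type) (r : rel T) (r' : rel U) : rel (T * U) :=
  fun x y => r x.1 y.1 && r' x.2 y.2.

Lemma mchains_prod (T U : Type) (s : seq T) (s' : seq U) r r' c (y : T * U) :
  mchains [seq (z, z') | z <- s, z' <- s'] (prod_rel r r') c y =
  mchains s r c y.1 * mchains s' r' c y.2.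
Proof.
elim: c y => //= c IHc [y y']; rewrite big_mkcond big_allpairs big_distrl /= [RHS]big_mkcond.
apply: eq_bigr => z _; rewrite /prod_rel /=; case: (r y z) => /=; last first.
  by rewrite big1.
by rewrite -big_mkcond big_distrr /=; apply: eq_bigr => z' _; rewrite IHc.
Qed.

Lemma all_mchains_prod (T U : Type) (s : seq T) (s' : seq U) r r' c :
  all_mchains [seq (z, z') | z <- s, z' <- s'] (prod_rel r r') c =
  all_mchains s r c * all_mchains s' r' c.
Proof.
case: c => //= c; rewrite big_allpairs big_distrl /=.
apply: eq_bigr => z _; rewrite big_distrr /=.
by apply: eq_bigr => z' _; rewrite mchains_prod.
Qed.

End Multichains.

(** * Binomial inversion from multichains to complete chains *)

Section CompleteChains.

Variables (T : finType) (r : rel T).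
Hypotheses (r_refl : reflexive r) (r_trans : transitive r) (r_anti : antisymmetric r).
Variables (b t : T).
Hypotheses (r_bot : forall x, r b x) (r_top : forall x, r x t).

Let strict_chains l x :=
  #|[set s : l.-tuple T | path (strict r) x s && (last x s == t)]|.

Let strict_chains0 x : strict_chains 0 x = (x == t).
Proof.
rewrite /strict_chains; case: eqP => [xt | nxt].
  rewrite (_ : [set _ | _] = [set [tuple]]) ?cards1 //.
  by apply/setP=> s; rewrite !inE (tuple0 s) /= xt eqxx.
by apply/eqP; rewrite cards_eq0; apply/eqP/setP=> s; rewrite !inE (tuple0 s) /=; apply/eqP.
Qed.

Let strict_chainsS l x :
  strict_chains l.+1 x = \sum_(z | strict r x z) strict_chains l z.
Proof.
rewrite /strict_chains -sum1dep_card.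
rewrite (reindex (fun p : T * l.-tuple T => [tuple of p.1 :: p.2])) /=; last first.
  exists (fun s : l.+1.-tuple T => (thead s, [tuple of behead s])) => [[z s] _ | s _] /=.
    by congr pair; apply: val_inj.
  by rewrite [RHS]tuple_eta.
under [RHS]eq_bigr do rewrite -sum1dep_card.
by rewrite pair_big_dep /=; apply: eq_bigl => -[z s] /=; rewrite andbA.
Qed.

(** Multichains with [k] steps from [x] to [t]: as the end is fixed, [k'.+1] steps leave [k'] free
    elements, and zero steps force [x = t]. *)
Let weak_chains k x : nat :=
  if k is k'.+1 then mchains (enum T) r k' x else (x == t).

Let weak_chainsS k x : weak_chains k.+1 x = \sum_(z | r x z) weak_chains k z.
Proof.
case: k => [|k] /=; last by rewrite big_enum_cond.
by rewrite (bigD1 t) //= eqxx big1 // => z /andP[_ /negPf->].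
Qed.

Import GRing.Theory.
Local Open Scope ring_scope.

(** Pascal's rule, after a shift of the index in the terms with [h k.+1]. It performs the induction
    step of the inversion. *)
Let binomial_diff (h : nat -> int) l :
  \sum_(k < l.+1) (-1) ^+ (l - k) * 'C(l, k)%:Z * (h k.+1 - h k) =
  \sum_(k < l.+2) (-1) ^+ (l.+1 - k) * 'C(l.+1, k)%:Z * h k.
Proof.
pose d k := (-1) ^+ (l.+1 - k) * 'C(l, k)%:Z * h k.
have dE : \sum_(k < l.+1) d k = d 0 + \sum_(k < l.+1) d k.+1.
  by rewrite big_ord_recl [X in _ = _ + X]big_ord_recr /= [d l.+1]/d bin_small // mulr0 mul0r addr0.
have -> : \sum_(k < l.+1) (-1) ^+ (l - k) * 'C(l, k)%:Z * (h k.+1 - h k) =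
    \sum_(k < l.+1) (-1) ^+ (l - k) * 'C(l, k)%:Z * h k.+1 + \sum_(k < l.+1) d k.
  rewrite -big_split; apply: eq_bigr => k _ /=.
  have kl : (k <= l)%N by rewrite -ltnS.
  by rewrite /d (subSn kl) exprS; ring.
rewrite dE [RHS]big_ord_recl addrCA; congr (_ + _).
  by rewrite /d !bin0.
rewrite -big_split; apply: eq_bigr => k _ /=.
by rewrite /d !subSS /bump leq0n add1n binS PoszD; ring.
Qed.

(** A strict step is a weak step minus the identity, so [l] strict steps expand as the [l]-th power
    of a difference of commuting operators. *)
Let strict_chainsE l x : (strict_chains l x)%:Z =
  \sum_(k < l.+1) (-1) ^+ (l - k) * 'C(l, k)%:Z * (weak_chains k x)%:Z.
Proof.
elim: l x => [|l IHl] x.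
  by rewrite big_ord1 strict_chains0 /= !mul1r.
have -> : (strict_chains l.+1 x)%:Z =
    \sum_(z | r x z) (strict_chains l z)%:Z - (strict_chains l x)%:Z.
  rewrite strict_chainsS [in RHS](bigD1 x) //= [RHS]addrC addKr (big_morph Posz PoszD (erefl _)).
  by apply: eq_bigl => z; rewrite eq_sym andbC.
under eq_bigr do rewrite IHl.
rewrite exchange_big IHl -sumrB -(binomial_diff (fun k => (weak_chains k x)%:Z)).
apply: eq_bigr => k _; rewrite weak_chainsS mulrBr -mulr_sumr.
by rewrite (big_morph Posz PoszD (erefl _)).
Qed.

Let strict_trans : transitive (strict r).
Proof.
move=> y x z /andP[xy rxy] /andP[yz ryz]; rewrite /strict /= (r_trans rxy ryz) andbT.
by apply: contraNneq xy => xz; apply/eqP/r_anti; rewrite rxy xz ryz.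
Qed.

Lemma card_complete_chains l : (#|complete_chains r l|)%:Z =
  \sum_(k < l.+1) (-1) ^+ (l - k) * 'C(l, k)%:Z *
    (if k : nat is k'.+1 then all_mchains (enum T) r k' else (b == t) : nat)%:Z.
Proof.
have -> : #|complete_chains r l| = strict_chains l b.
  rewrite /strict_chains -!sum1dep_card.
  rewrite (reindex (fun s : l.-tuple T => [tuple of b :: s])) /=; last first.
    exists (fun s : l.+1.-tuple T => [tuple of behead s]) => [s _ | s].
      by apply: val_inj.
    rewrite inE => /and3P[srt has_min _]; apply: val_inj => /=.
    case/tupleP: s srt has_min => x s /= srt has_min.
    have {has_min}[y] : exists2 y, y \in x :: s & is_minimum r y by apply/hasP.
    rewrite inE.
    case/orP=> [/eqP-> | ys] /forallP miny.
      by congr (_ :: _); apply: r_anti; rewrite r_bot miny.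
    have /allP/(_ y ys)/andP[xy rxy] := order_path_min strict_trans srt.
    by case/eqP: xy; apply: r_anti; rewrite rxy miny.
  apply: eq_bigl => s; apply: andb_id2l => srt.
  have -> /= : is_minimum r b by apply/forallP.
  apply/orP/eqP => [max | lst]; last first.
    have : t \in b :: s by rewrite -lst mem_last.
    rewrite inE => /orP[/eqP <- | ts]; [left | right; apply/hasP; exists t => //].
      by apply/forallP.
    by apply/forallP.
  have [y ys maxy] : exists2 y, y \in b :: s & is_maximum r y.
    case: max => [maxb | /hasP[y ys maxy]]; first by exists b; rewrite ?mem_head.
    by exists y => //; rewrite inE ys orbT.
  have yt : y = t by apply: r_anti; rewrite r_top (forallP maxy).
  (* The top element must end the chain, since a further element would lie strictly above it. *)
  case/splitPl: ys srt => p1 p2 lst; rewrite cat_path last_cat lst yt => /andP[_].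
  case: p2 => //= z p2 /andP[/andP[/eqP tz rtz] _]; case: tz.
  by apply: r_anti; rewrite rtz r_top.
rewrite strict_chainsE; apply: eq_bigr => k _; congr (_ * Posz _).
case: (val k) => [|k'] //=; case: k' => //= k'.
by apply: eq_bigl => z; rewrite r_bot.
Qed.
End CompleteChains.

(** * Multichains of lattice paths *)

Section Lists.

Fixpoint lists (T : Type) (s : seq T) (c : nat) : seq (seq T) :=
  if c is c'.+1 then [seq x :: l | x <- s, l <- lists s c'] else [:: [::]].

Lemma size_lists (T : eqType) (s : seq T) c l : l \in lists s c -> size l = c.
Proof.
elim: c l => [|c IHc] l /=; first by rewrite inE => /eqP->.
by case/allpairsP=> -[x l'] [_ /IHc /= <- ->].
Qed.

Lemma lists_uniq (T : eqType) (s : seq T) c : uniq s -> uniq (lists s c).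
Proof.
move=> us; elim: c => //= c IHc; apply: allpairs_uniq => //.
by move=> [x l] [x' l'] _ _ /= [-> ->].
Qed.

Lemma mem_lists (T : eqType) (s : seq T) c l :
  (l \in lists s c) = (size l == c) && all (mem s) l.
Proof.
elim: c l => [|c IHc] [|x l] //=; first by apply/allpairsP => -[[y l'] [_ _]].
rewrite eqSS [RHS]andbCA -IHc; apply/allpairsP/andP => [[[y l'] [ys ls [-> ->]]] //|[xs ls]].
by exists (x, l).
Qed.

Lemma lists_filter (T : Type) (p : pred T) (s : seq T) c :
  lists (filter p s) c = filter (all p) (lists s c).
Proof.
elim: c => //= c ->; move: (lists s c) => L.
elim: s => //= x s IHs; rewrite filter_cat -IHs.
rewrite filter_map; case px: (p x) => /=.
  by congr (map _ _ ++ _); apply: eq_filter => l /=; rewrite px.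
have -> // : [seq l <- L | preim (cons x) (all p) l] = [::].
by rewrite (@eq_filter _ _ pred0) ?filter_pred0 // => l /=; rewrite px.
Qed.

Lemma big_listsS (R : Type) (idx : R) (op : Monoid.law idx)
    (T : Type) (s : seq T) c (G : seq T -> R) :
  \big[op/idx]_(l <- lists s c.+1) G l =
  \big[op/idx]_(x <- s) \big[op/idx]_(l <- lists s c) G (x :: l).
Proof. by rewrite /= big_allpairs_dep. Qed.

Lemma mchains_lists (T : Type) (s : seq T) r c y :
  mchains s r c y = \sum_(l <- lists s c) path r y l.
Proof.
elim: c y => [|c IHc] y; first by rewrite big_seq1.
rewrite big_listsS /= big_mkcond; apply: eq_bigr => z _.
by case: (r y z) => /=; rewrite ?IHc // big1.
Qed.

Lemma all_mchains_lists (T : Type) (s : seq T) r c :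
  all_mchains s r c = \sum_(l <- lists s c) sorted r l.
Proof.
case: c => [|c]; first by rewrite big_seq1.
by rewrite big_listsS /=; apply: eq_bigr => z _; rewrite mchains_lists.
Qed.

Definition zipcons (T : Type) (e : seq T) (l : seq (seq T)) :=
  [seq p.1 :: p.2 | p <- zip e l].

(** An array of [c] words is read by its first column [e] and the array that remains; this allows a
    recursion on the length of the words with all of them advancing together. *)
Lemma big_lists_transpose (T : Type) (s : seq T) n c (G : seq (seq T) -> nat) :
  \sum_(l <- lists (lists s n.+1) c) G l =
  \sum_(e <- lists s c) \sum_(l <- lists (lists s n) c) G (zipcons e l).
Proof.
elim: c G => [|c IHc] G; first by rewrite !big_seq1.
rewrite !big_listsS; apply: eq_bigr => b _.
under [RHS]eq_bigr do rewrite big_listsS.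
rewrite [RHS]exchange_big; apply: eq_bigr => x _ /=.
by rewrite (IHc (fun l => G ((b :: x) :: l))).
Qed.

End Lists.

(** * Plane partitions in a box *)

Section BoxMultichains.

Notation bools := [:: true; false].
Notation cnt := (count id).

(* A lattice path is a word of booleans; paths are compared through the counts *)
(* of [true] in their suffixes.                                                *)
Fixpoint cle (x y : seq bool) : bool :=
  match x, y with
  | [::], [::] => true
  | b :: x', b' :: y' => (cnt x <= cnt y) && cle x' y'
  | _, _ => false
  end.

(** Prescribing a separate count for each word makes the recursion on [n] possible, with [y] as its
    state; multichains of paths in a box are the case of a constant [y]. *)
Let walks n (y : seq nat) :=
  \sum_(l <- lists (lists bools n) (size y)) (sorted cle l && (map cnt l == y)).

Lemma sorted_zipcons e l : size e = size l ->
  sorted cle (zipcons e l) = sorted leq (map cnt (zipcons e l)) && sorted cle l.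
Proof.
case: e l => [|b e] [|x l] //= [].
elim: e b x l => [|b' e IHe] b x [|x' l] //= [szl].
by rewrite IHe //= -!andbA; do !bool_congr.
Qed.

Lemma map_cnt_zipcons (e : seq bool) l : size e = size l ->
  map cnt (zipcons e l) = [seq nat_of_bool p.1 + p.2 | p <- zip e (map cnt l)].
Proof. by elim: e l => [|b e IHe] [|x l] //= [/IHe->]. Qed.

Lemma cle_cnt x y : cle x y -> cnt x <= cnt y.
Proof. by case: x y => [|b x] [|b' y] //= /andP[]. Qed.

Lemma sorted_map_cnt l : sorted cle l -> sorted leq (map cnt l).
Proof. by case: l => //= x l; rewrite path_map; apply: sub_path => ? ? /cle_cnt. Qed.

Let lower (y : seq nat) (e : seq bool) := [seq p.1 - nat_of_bool p.2 | p <- zip y e].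
Let below (y : seq nat) (e : seq bool) := all (fun p => nat_of_bool p.2 <= p.1) (zip y e).

Lemma add_eq_lower (e : seq bool) (z y : seq nat) :
    size e = size y -> size z = size y ->
  ([seq nat_of_bool p.1 + p.2 | p <- zip e z] == y) = below y e && (z == lower y e).
Proof.
elim: e z y => [|b e IHe] [|z0 z] [|y0 y] //= [se] [sz].
rewrite /below /lower /= !eqseq_cons IHe //; rewrite /below /lower.
case: (leqP b y0) => /= [by0|]; last by case: eqP => //=; lia.
by rewrite andbCA; congr (_ && (_ && _)); apply/eqP/eqP; lia.
Qed.

(** Removing the first letters [e] lowers the counts by [e]. Comparing the longer words adds only
    the condition that their counts increase, which is the hypothesis on [y]. *)
Let walksS n y : sorted leq y ->
  walks n.+1 y = \sum_(e <- lists bools (size y) | below y e) walks n (lower y e).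
Proof.
move=> sy; rewrite /walks big_lists_transpose [RHS]big_mkcond.
rewrite big_seq [RHS]big_seq; apply: eq_bigr => e /size_lists se.
have -> : size (lower y e) = size y by rewrite size_map size_zip se minnn.
case: ifP => [bye | nbye].
  rewrite big_seq [RHS]big_seq; apply: eq_bigr => l /size_lists sl.
  rewrite sorted_zipcons ?se // map_cnt_zipcons ?se //.
  rewrite -[map cnt l == _]andTb -bye -add_eq_lower ?size_map ?se //.
  by case: eqP => [-> | _]; rewrite ?sy // !andbF.
rewrite big_seq big1 // => l /size_lists sl.
by rewrite map_cnt_zipcons ?se // add_eq_lower ?size_map ?se // nbye andbF.
Qed.

Let walks0 y : walks 0 y = (y == nseq (size y) 0).
Proof.
rewrite /walks; have -> c : lists (lists bools 0) c = [:: nseq c [::]].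
  by elim: c => //= c ->.
rewrite big_seq1 map_nseq /= eq_sym.
by case: (size y) => //= c; rewrite (_ : path _ _ _) //; elim: c.
Qed.

Import GRing.Theory.
Local Open Scope ring_scope.

Lemma sum_prod_bools c (h : 'I_c -> bool -> int) :
  \sum_(e <- lists bools c) \prod_(i < c) h i (nth false e i) =
  \prod_(i < c) (h i true + h i false).
Proof.
elim: c h => [|c IHc] h; first by rewrite big_seq1 !big_ord0.
rewrite big_ord_recl -(IHc (fun i => h (lift ord0 i))) big_listsS.
rewrite !big_cons big_nil /= addr0 mulrDl; congr (_ + _); rewrite big_distrr /=;
  by apply: eq_bigr => e _; rewrite big_ord_recl.
Qed.

Lemma sum_det_bools c (R : 'I_c -> bool -> 'I_c -> int) :
  \sum_(e <- lists bools c) \det (\matrix_(i, j) R i (nth false e i) j) =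
  \det (\matrix_(i, j) (R i true j + R i false j)).
Proof.
rewrite /determinant exchange_big /=; apply: eq_bigr => s _.
rewrite -mulr_sumr; congr (_ * _).
transitivity (\sum_(e <- lists bools c) \prod_i R i (nth false e i) (s i)).
  by apply: eq_bigr => e _; apply: eq_bigr => i _; rewrite mxE.
rewrite (sum_prod_bools (fun i b => R i b (s i))).
by apply: eq_bigr => i _; rewrite mxE.
Qed.

(** Up to column operations this is the Lindström-Gessel-Viennot determinant of the
    ['C(n, y_i + i - j)]: adding [i] turns weakly ordered walks into non-intersecting ones. In the
    present form Pascal's rule applies row by row. *)
Let walk_det c n (y : seq nat) :=
  \det (\matrix_(i < c, j < c) 'C(n + j, nth 0%N y i + i)%:Z).

(** The guard avoids truncated subtraction: a row lowered below zero has to vanish. *)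
Let walk_row n (y : seq nat) i (b : bool) (j : nat) : int :=
  if (b <= nth 0 y i + i)%N then 'C(n + j, nth 0%N y i + i - b)%:Z else 0.

Lemma det_row0 c (A : 'M[int]_c) i : (forall j, A i j = 0) -> \det A = 0.
Proof. by move=> Ai0; rewrite (expand_det_row _ i) big1 // => j _; rewrite Ai0 mul0r. Qed.

(* If lowering the entries of [y] selected by [e] breaks monotonicity or       *)
(* positivity, then two rows coincide or the first row vanishes.               *)
Let walk_det_lower n y e : sorted leq y -> size e = size y ->
  \det (\matrix_(i < size y, j < size y) walk_row n y i (nth false e i) j) =
  if below y e && sorted leq (lower y e) then walk_det (size y) n (lower y e) else 0.
Proof.
move=> sy se.
have nth_lower i : (i < size y)%N -> nth 0%N (lower y e) i = (nth 0 y i - nth false e i)%N.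
  move=> iy; rewrite (nth_map (0%N, false)) ?size_zip ?se ?minnn //.
  by rewrite nth_zip ?se.
have size_lower : size (lower y e) = size y by rewrite size_map size_zip se minnn.
have belowP : reflect (forall i, (i < size y)%N -> (nth false e i <= nth 0 y i)%N) (below y e).
  apply: (iffP (all_nthP (0%N, false))) => H i; move: (H i); rewrite size_zip se minnn;
    by move=> Hi iy; move: (Hi iy); rewrite nth_zip ?se.
have sortedyP i : (i.+1 < size y)%N -> (nth 0 y i <= nth 0 y i.+1)%N.
  by move=> iy; move/(sortedP 0%N): sy; apply.
(* Entries of the sorted [y] drop by at most one, so this is the only way to break the order at [i];
   the shifts by [i] and [i.+1] then make the two rows equal. *)
pose bad i := [&& ~~ nth false e i, nth false e i.+1 & nth 0 y i == nth 0 y i.+1]%N.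
have [/existsP[i /andP[iy badi]] | nbad] := boolP [exists i : 'I_(size y),
  (i.+1 < size y)%N && bad i].
  case/and3P: badi => nei ei1 /eqP yi; case: ifP => [/andP[/belowP bye /(sortedP 0%N)] | _].
    rewrite size_lower => /(_ i iy); rewrite !nth_lower // yi (negPf nei) ei1.
    by move: (bye _ iy); rewrite ei1; lia.
  apply: (@determinant_alternate _ _ _ i (Ordinal iy)) => [|j].
    by rewrite -val_eqE /= neq_ltn ltnSn.
  by rewrite !mxE /walk_row /= (negPf nei) ei1 yi leq0n addnS /= subSS subn0.
have {}nbad i : (i.+1 < size y)%N -> ~~ bad i.
  move=> iy; apply: contraNN nbad => badi; apply/existsP.
  by exists (Ordinal (ltnW iy)); rewrite /= iy.
have [/andP[y0 /andP[e0 /eqP y00]] | ne0] := boolP [&& 0 < size y,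
  nth false e 0 & nth 0 y 0 == 0]%N.
  case: ifP => [/andP[/belowP/(_ 0%N y0)] | _]; first by rewrite e0 y00.
  apply: (@det_row0 _ _ (Ordinal y0)) => j.
  by rewrite mxE /walk_row /= e0 y00.
(* Positivity propagates from the first entry: if [i.+1] is lowered and [i] is not, then [y]
   increases strictly between them because [i] is not bad. *)
have bye i : (i < size y)%N -> (nth false e i <= nth 0 y i)%N.
  elim: i => [|i IHi] iy.
    by move: ne0; rewrite iy /=; case: (nth false e 0) => //=; rewrite -lt0n.
  move: (nbad i iy) (IHi (ltnW iy)) (sortedyP i iy); rewrite /bad.
  by case: (nth false e i); case: (nth false e i.+1) => //=; lia.
have -> : below y e by apply/belowP.
have -> : sorted leq (lower y e).
  apply/(sortedP 0%N) => i; rewrite size_lower => iy; rewrite !nth_lower ?(ltnW iy) //.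
  move: (nbad i iy) (bye i (ltnW iy)) (bye _ iy) (sortedyP i iy); rewrite /bad.
  by case: (nth false e i); case: (nth false e i.+1) => //=; lia.
congr determinant; apply/matrixP => i j; rewrite !mxE /walk_row nth_lower //.
move: (bye i (ltn_ord i)) => byi; rewrite ifT; last by lia.
by congr (Posz 'C(_, _)); lia.
Qed.

Lemma walks_det n y : sorted leq y -> (walks n y)%:Z = walk_det (size y) n y.
Proof.
elim: n y => [|n IHn] y sy.
  rewrite walks0; case: eqP => [-> | /eqP ny].
    rewrite size_nseq /walk_det -det_tr det_trig.
      by rewrite big1 // => i _; rewrite !mxE nth_nseq ltn_ord binn.
    apply/is_trig_mxP => i j ij; rewrite !mxE nth_nseq ltn_ord.
    by rewrite bin_small.
  (* The last entry of [y] is then positive, so the lower index of the binomials in the last row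
     exceeds every column index [j]. *)
  have [i iy yi] : exists2 i, (i < size y)%N & (0 < nth 0 y i)%N.
    apply/(has_nthP 0%N); apply: contraNT ny; rewrite -all_predC => y0.
    apply/eqP/all_pred1P; apply: sub_all y0 => x /=; lia.
  have sz0 : (0 < size y)%N by case: (y) iy.
  pose i0 := Ordinal (etrans (ltn_predL _) sz0).
  rewrite /walk_det (@det_row0 _ _ i0) // => j; rewrite mxE bin_small //=.
  have : (nth 0 y i <= nth 0 y (size y).-1)%N.
    apply: (sorted_leq_nth leq_trans leqnn 0%N sy); rewrite ?inE ?prednK //.
    by rewrite -ltnS prednK.
  by move: (ltn_ord j); lia.
rewrite walksS // (big_morph Posz PoszD (erefl _)) big_mkcond /=.
rewrite /walk_det; transitivity (\det (\matrix_(i < size y, j < size y)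
    (walk_row n y i true j + walk_row n y i false j))); last first.
  congr determinant; apply/matrixP => i j; rewrite !mxE /walk_row /=.
  by case: (_ + _)%N => [|m]; rewrite /= ?add0r ?subn0 ?bin0 // subn1 addSn binS PoszD addrC.
rewrite -(sum_det_bools (fun i b j => walk_row n y i b j)).
rewrite big_seq [RHS]big_seq; apply: eq_bigr => e /size_lists se.
have size_lower : size (lower y e) = size y by rewrite size_map size_zip se minnn.
rewrite walk_det_lower //; case: (below y e) => //=; case: ifP => [/IHn -> | ns].
  by rewrite size_lower.
rewrite /walks big1 // => l _; case: eqP => [El | _]; last by rewrite andbF.
by rewrite andbT; case srt: (sorted cle l) => //; move: (sorted_map_cnt srt); rewrite El ns.
Qed.

Definition paths a b := [seq x <- lists bools (a + b) | cnt x == a].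

Lemma all_mchains_paths_det a b c : (all_mchains (paths a b) cle c)%:Z =
  \det (\matrix_(i < c, j < c) 'C(a + b + j, a + i)%:Z).
Proof.
have -> : all_mchains (paths a b) cle c = walks (a + b) (nseq c a).
  rewrite all_mchains_lists lists_filter big_filter big_mkcond /walks size_nseq.
  rewrite big_seq [RHS]big_seq; apply: eq_bigr => l /size_lists sl.
  have -> : (map cnt l == nseq c a) = all (fun x => cnt x == a) l.
    rewrite -(all_map cnt (pred1 a)) -[in nseq c a]sl -(size_map cnt l).
    by apply/eqP/all_pred1P.
  by case: all; rewrite ?andbT ?andbF.
rewrite walks_det ?size_nseq; last first.
  by apply/(sortedP 0%N) => i; rewrite size_nseq => ic; rewrite !nth_nseq ic (ltnW ic).
by congr determinant; apply/matrixP => i j; rewrite !mxE nth_nseq ltn_ord.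
Qed.

(** Vandermonde's convolution factors the matrix into a lower and an upper unitriangular one. *)
Lemma det_binomial_unit b c : \det (\matrix_(i < c, j < c) 'C(b + j, i)%:Z) = 1.
Proof.
have -> : \matrix_(i < c, j < c) 'C(b + j, i)%:Z =
    (\matrix_(i < c, k < c) (if (k <= i)%N then 'C(b, i - k)%:Z else 0)) *m
    (\matrix_(k < c, j < c) 'C(j, k)%:Z) :> 'M[int]_c.
  apply/matrixP => i j; rewrite !mxE addnC -binomial.Vandermonde (big_morph Posz PoszD (erefl _)).
  under [RHS]eq_bigr do rewrite !mxE.
  rewrite (big_ord_widen c (fun k => ('C(j, k) * 'C(b, i - k))%:Z)) ?ltn_ord //.
  rewrite big_mkcond; apply: eq_bigr => k _; rewrite ltnS.
  by case: ifP; rewrite ?mul0r // PoszM mulrC.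
rewrite det_mulmx det_trig; last first.
  by apply/is_trig_mxP => i j ij; rewrite mxE leqNgt ij.
rewrite -det_tr det_trig; last first.
  by apply/is_trig_mxP => i j ij; rewrite !mxE bin_small.
rewrite !big1 ?mulr1 // => i _; rewrite !mxE ?binn //.
by rewrite leqnn subnn bin0.
Qed.

(* MacMahon's count of plane partitions in an [a * b * c] box.                 *)
Lemma all_mchains_paths a b c :
  (all_mchains (paths a b) cle c * \prod_(j < c) ((a + j)`! * (b + j)`!) =
   \prod_(j < c) ((a + b + j)`! * j`!))%N.
Proof.
apply: (can_inj absz_nat); rewrite !PoszM all_mchains_paths_det.
rewrite !(big_morph Posz PoszM (erefl _)).
under eq_bigr do rewrite PoszM.
under [RHS]eq_bigr do rewrite PoszM.
rewrite !big_split /=.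
pose dg (f : nat -> nat) : 'M[int]_c := diag_mx (\row_(i < c) (f i)%:Z).
have det_dg f : \det (dg f) = \prod_(i < c) (f i)%:Z.
  by rewrite det_diag; apply: eq_bigr => i _; rewrite mxE.
(* Once the row and column factorials are cleared, both binomials leave the same factor, the inverse
   of [(b + j - i)!]; both vanish when [i > b + j]. *)
suff /(congr1 determinant) :
    dg (fun i => (a + i)`!) *m (\matrix_(i, j) 'C(a + b + j, a + i)%:Z) *m dg (fun j => (b + j)`!)
    = dg (fun i => i`!) *m (\matrix_(i, j) 'C(b + j, i)%:Z) *m dg (fun j => (a + b + j)`!).
  rewrite !det_mulmx !det_dg det_binomial_unit mulr1 => E.
  by rewrite mulrA [X in X * _]mulrC E mulrC.
apply/matrixP => i j; rewrite mul_mx_diag mul_diag_mx mul_mx_diag mul_diag_mx !mxE. rewrite -!PoszM.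
congr Posz; case: (leqP i (b + j)) => ij; last by rewrite !bin_small ?mul0n ?muln0 //; lia.
apply/eqP; rewrite -(eqn_pmul2r (fact_gt0 (b + j - i))); apply/eqP.
have := bin_fact ij.
have : (a + i <= a + b + j)%N by lia.
move/bin_fact; rewrite (_ : a + b + j - (a + i) = b + j - i)%N; last by lia.
move=> <- <-; ring.
Qed.

(* The number of multichains of length [c] in a product of chains with           *)
(* [1, 2, ..., n] elements.                                                      *)
Definition staircase_count c n := (\prod_(i < n) 'C(c + i, i))%N.

(** The point of this closed form is that [j.+1 ^ n] is multiplicative in [n], so that these powers
    cancel when the counts for [a] and [b] are compared with the count for [a + b]. *)
Lemma staircase_countE c n :
  (staircase_count c n * \prod_(j < c) (j`! * j.+1 ^ n) = \prod_(j < c) (n + j)`!)%N.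
Proof.
elim: c => [|c IHc].
  by rewrite !big_ord0 muln1 /staircase_count big1 // => i _; rewrite add0n binn.
rewrite !big_ord_recr /= -IHc.
have : (staircase_count c.+1 n * (c`! * c.+1 ^ n) = staircase_count c n * (n + c)`!)%N.
  rewrite /staircase_count; elim: n {IHc} => [|n IHn]; first by rewrite !big_ord0 expn0 muln1.
  have E2 : ('C(c.+1 + n, n) * c.+1 = 'C(c + n, n) * (n + c).+1)%N.
    rewrite -(@bin_sub (c.+1 + n) n) ?leq_addl // -(@bin_sub (c + n) n) ?leq_addl // !addnK.
    by rewrite mulnC -mul_bin_diag addSn /= mulnC addnC.
  rewrite !big_ord_recr (addSn n c) factS expnS /=.
  transitivity (\prod_(i < n) 'C(c.+1 + i, i) * (c`! * c.+1 ^ n) * ('C(c.+1 + n, n) * c.+1))%N.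
    by ring.
  by rewrite IHn E2; ring.
by move=> E; rewrite mulnCA E; ring.
Qed.

Lemma all_mchains_paths_staircase a b c :
  (all_mchains (paths a b) cle c * (staircase_count c a * staircase_count c b) =
   staircase_count c (a + b))%N.
Proof.
pose Q m := (\prod_(j < c) (j`! * j.+1 ^ m))%N.
have Q0 m : (0 < Q m)%N by rewrite prodn_gt0 // => j; rewrite muln_gt0 fact_gt0 expn_gt0.
have QD : (Q a * Q b = Q (a + b) * \prod_(j < c) j`!)%N.
  by rewrite -!big_split; apply: eq_bigr => j _ /=; rewrite expnD; ring.
have := all_mchains_paths a b c; rewrite !big_split /=.
move: (staircase_countE c a) (staircase_countE c b) (staircase_countE c (a + b)).
rewrite -!/(Q _) => <- <- <- E.
apply/eqP; rewrite -(eqn_pmul2r (Q0 a)) -(eqn_pmul2r (Q0 b)); apply/eqP.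
transitivity (all_mchains (paths a b) cle c * (staircase_count c a * Q a * (staircase_count c b * Q b)))%N; first by ring.
by rewrite E -!mulnA QD.
Qed.
End BoxMultichains.

(** * Birkhoff's representation *)

Section Birkhoff.

Variables (T : finType) (r : rel T) (meet join : T -> T -> T).
Hypotheses (r_refl : reflexive r) (r_trans : transitive r) (r_anti : antisymmetric r).
Hypothesis r_meet : forall x y z, r x (meet y z) = r x y && r x z.
Hypothesis r_join : forall x y z, r (join x y) z = r x z && r y z.
Hypothesis meet_join : forall x y z, meet x (join y z) = join (meet x y) (meet x z).

Definition join_irreducible (p : T) : bool :=
  ~~ [forall x, r p x] &&
  [forall x, forall y, (p == join x y) ==> (p == x) || (p == y)].

Definition irreducibles_below (v : T) : {set T} := [set p | join_irreducible p && r p v].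

Notation I := irreducibles_below.

Lemma irreducibles_below_meet v w : I (meet v w) = I v :&: I w.
Proof. by apply/setP=> p; rewrite !inE r_meet; case: join_irreducible. Qed.

Lemma le_joinl x y : r x (join x y).
Proof. by have := r_join x y (join x y); rewrite r_refl => /esym/andP[]. Qed.

Lemma le_joinr x y : r y (join x y).
Proof. by have := r_join x y (join x y); rewrite r_refl => /esym/andP[]. Qed.

Lemma meet_eq x y : r x y -> meet x y = x.
Proof.
move=> xy; apply: r_anti; rewrite r_meet r_refl xy !andbT.
by have := r_meet (meet x y) x y; rewrite r_refl => /esym/andP[].
Qed.

Lemma le_meetr x y : r (meet x y) y.
Proof. by have := r_meet (meet x y) x y; rewrite r_refl => /esym/andP[]. Qed.

(** Distributivity makes a join-irreducible element prime: below [join v w], it is the join of its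
    meets with [v] and [w], hence equal to one of them. *)
Lemma irreducibles_below_join v w : I (join v w) = I v :|: I w.
Proof.
apply/setP=> p; rewrite !inE; case irr: (join_irreducible p) => //=.
apply/idP/orP => [pvw | [pv | pw]]; last 2 first.
- exact: r_trans pv (le_joinl v w).
- exact: r_trans pw (le_joinr v w).
case/andP: irr => _ /forallP/(_ (meet p v))/forallP/(_ (meet p w)).
by rewrite -meet_join meet_eq // eqxx /= => /orP[] /eqP Ep; [left | right];
  rewrite {1}Ep le_meetr.
Qed.

Lemma irreducibles_below_subset v w : (I v \subset I w) = r v w.
Proof.
apply/idP/idP => [sub | vw]; last first.
  by apply/subsetP=> p; rewrite !inE => /andP[-> /r_trans]; apply.
apply/negPn/negP => nvw.
(* A minimal element below [v] and not below [w] is join-irreducible, since all elements strictly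
   below it lie below [w]. *)
pose size_below x := #|[set y | r y x]|.
pose x := [arg min_(x < v | r x v && ~~ r x w) size_below x].
have [{}x /andP[xv nxw] minx] : extremum_spec leq (fun x => r x v && ~~ r x w) size_below x.
  by apply: arg_minnP; rewrite r_refl.
have minimal y : r y x -> y != x -> r y w.
  move=> yx nyx; apply/negPn/negP => nyw.
  have := minx y; rewrite nyw (r_trans yx xv) => /(_ isT); rewrite leqNgt => /negP; apply.
  apply: proper_card; apply/properP; split.
    by apply/subsetP=> z; rewrite !inE => /r_trans; apply.
  exists x; rewrite !inE ?r_refl //; apply: contra nyx => xy.
  by apply/eqP/r_anti; rewrite yx.
have : x \in I w.
  apply: (subsetP sub); rewrite inE xv andbT; apply/andP; split.
    by apply/forallP => /(_ w); rewrite (negPf nxw).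
  apply/forallP=> y; apply/forallP=> z; apply/implyP=> /eqP xyz.
  apply: contraT => /norP[nxy nxz]; case/negP: nxw.
  rewrite {1}xyz r_join !minimal //; rewrite 1?eq_sym //.
    by rewrite xyz le_joinr.
  by rewrite xyz le_joinl.
by rewrite inE (negPf nxw) andbF.
Qed.

(** Each new irreducible [p] satisfies [join v p = w]; by primality any other new one lies below
    [p], and conversely. *)
Lemma card_irreducibles_cover v w :
    r v w -> v != w -> (forall z, r v z -> r z w -> z = v \/ z = w) ->
  #|I w :\: I v| = 1.
Proof.
move=> vw nvw cov.
have above p : p \in I w :\: I v -> join v p = w.
  rewrite !inE => /andP[npv /andP[irr pw]].
  case: (cov (join v p)) => //; rewrite ?le_joinl ?r_join ?vw // => E.
  by case/negP: npv; rewrite irr -E le_joinr.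
have le_all p q : p \in I w :\: I v -> q \in I w :\: I v -> r q p.
  move=> /above E; rewrite -E irreducibles_below_join !inE.
  by case/andP=> nqv; rewrite (negPf nqv) => /andP[].
have [E | [p pin]] := set_0Vmem (I w :\: I v).
  case/eqP: nvw; apply: r_anti; rewrite vw -irreducibles_below_subset.
  by apply/subsetP=> p pw; apply: contraT => pv; have := in_set0 p; rewrite -E inE pv pw.
rewrite (_ : _ :\: _ = [set p]) ?cards1 //; apply/setP=> q; rewrite in_set1.
apply/idP/eqP => [qin | -> //].
by apply: r_anti; rewrite !le_all.
Qed.

Lemma irreducibles_below_bottom v : (forall x, r v x) -> I v = set0.
Proof.
move=> bot; apply/setP=> p; rewrite !inE; apply/negP => /andP[/andP[/negP nbot _] pv].
by apply: nbot; apply/forallP => x; apply: r_trans pv (bot x).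
Qed.

End Birkhoff.

Section DistrLatticeOps.

Import Order.TTheory.

Lemma distr_lattice_ops (T : Type) (r : rel T) : distr_lattice_order r ->
  exists meet join : T -> T -> T,
    [/\ reflexive r, transitive r & antisymmetric r] /\
    [/\ forall x y z, r x (meet y z) = r x y && r x z,
        forall x y z, r (join x y) z = r x z && r y z
      & forall x y z, meet x (join y z) = join (meet x y) (meet x z)].
Proof.
case=> d [c rE]; pose L := Order.DistrLattice.Pack c.
exists (@Order.meet d L), (@Order.join d L); split; split.
- by move=> x; rewrite rE; apply: lexx.
- by move=> y x z; rewrite !rE; apply: le_trans.
- by move=> x y; rewrite !rE; apply: le_anti.
- by move=> x y z; rewrite !rE; apply: lexI.
- by move=> x y z; rewrite !rE; apply: leUx.
- by move=> x y z; apply: (@meetUr d L).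
Qed.

End DistrLatticeOps.

(** * Words *)

Section Words.

Import GroupScope.

Fixpoint inv (s : seq nat) : nat :=
  if s is x :: s' then count (fun y => y < x) s' + inv s' else 0.

Definition exchange (a b x : nat) : nat := if x == a then b else if x == b then a else x.

Lemma exchangeC a b : exchange a b =1 exchange b a.
Proof. by move=> x; rewrite /exchange; do 2 case: eqP => //; move=> -> ->. Qed.

Lemma exchangel a b : exchange a b a = b.
Proof. by rewrite /exchange eqxx. Qed.

Lemma exchanger a b : exchange a b b = a.
Proof. by rewrite exchangeC exchangel. Qed.

Lemma exchange_id a b x : x != a -> x != b -> exchange a b x = x.
Proof. by rewrite /exchange => /negPf-> /negPf->. Qed.

Lemma exchangeK a b : involutive (exchange a b).
Proof.
move=> x; have [-> | nxa] := eqVneq x a; first by rewrite exchangel exchanger.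
have [-> | nxb] := eqVneq x b; first by rewrite exchanger exchangel.
by rewrite !exchange_id.
Qed.

Lemma map_exchange_id a b (s : seq nat) : a \notin s -> b \notin s -> map (exchange a b) s = s.
Proof.
move=> na nb; rewrite -[RHS]map_id; apply/eq_in_map => x xs.
by apply: exchange_id; [apply: contraNneq na | apply: contraNneq nb] => <-.
Qed.

Lemma inv_cat s t : inv (s ++ t) = inv s + \sum_(x <- s) count (fun y => y < x) t + inv t.
Proof.
elim: s => [|x s IHs] /=; first by rewrite big_nil.
by rewrite big_cons IHs count_cat; lia.
Qed.

Lemma inv_sorted s : sorted ltn s -> inv s = 0.
Proof.
elim: s => //= x s IHs xs; rewrite IHs ?(path_sorted xs) // addn0.
have /allP lt_x := order_path_min ltn_trans xs.
by apply/eqP; rewrite -leqn0 leqNgt -has_count; apply/hasPn => y /lt_x; rewrite -leqNgt => /ltnW.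
Qed.

Lemma inv_rev s : uniq s -> inv s + inv (rev s) = 'C(size s, 2).
Proof.
elim: s => //= x s IHs /andP[xs us]; rewrite rev_cons -cats1 inv_cat /= binS bin1 -IHs //.
have -> : \sum_(y <- rev s) ((x < y) + 0) = count (fun y => x < y) s.
  by rewrite -(count_rev _ s) -sum1_count [RHS]big_mkcond;
    apply: eq_bigr => y _; rewrite addn0; case: ltnP.
have -> : count (fun y => x < y) s = count (predC (fun y => y < x)) s.
  apply: eq_in_count => y ys /=; rewrite -leqNgt [RHS]leq_eqVlt; case: eqP => // xy.
  by rewrite xy ys in xs.
by have := count_predC (fun y => y < x) s; lia.
Qed.

Lemma inv_swap A i j B : i < j -> inv (A ++ j :: i :: B) = (inv (A ++ i :: j :: B)).+1.
Proof.
move=> ij; rewrite !inv_cat /= ij (ltnNge j) (ltnW ij) /=.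
rewrite (eq_bigr (fun x => (i < x) + ((j < x) + count (fun y => y < x) B))) => [|x _]; lia.
Qed.

Variable n : nat.
Implicit Types v w x : 'S_n.

Definition word v : seq nat := [seq val (v i) | i <- enum 'I_n].

Lemma size_word v : size (word v) = n.
Proof. by rewrite size_map size_enum_ord. Qed.

Lemma nth_word v (i : 'I_n) : nth 0 (word v) i = v i.
Proof. by rewrite (nth_map i) ?size_enum_ord ?nth_ord_enum. Qed.

Lemma word_uniq v : uniq (word v).
Proof. by rewrite map_inj_uniq ?enum_uniq // => i j /val_inj/perm_inj. Qed.

Lemma word_inj : injective word.
Proof.
move=> v w /(congr1 (fun s => nth 0 s)) E; apply/permP=> i; apply: ord_inj.
by rewrite -!nth_word E.
Qed.

Lemma perm_word v : perm_eq (word v) (iota 0 n).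
Proof.
apply: uniq_perm; rewrite ?word_uniq ?iota_uniq // => k.
rewrite mem_iota leq0n add0n /=; apply/mapP/idP => [[i _ ->] | kn]; first exact: ltn_ord.
by exists (v^-1 (Ordinal kn)); rewrite ?mem_enum ?permKV.
Qed.

Lemma word_surj (s : seq nat) : perm_eq s (iota 0 n) -> exists v, word v = s.
Proof.
move=> sn; have ssz : size s = n by rewrite (perm_size sn) size_iota.
have lt_nth (i : 'I_n) : nth 0 s i < n.
  by have := mem_nth 0 (_ : i < size s); rewrite ssz ltn_ord (perm_mem sn) mem_iota; apply.
have inj : injective (fun i => Ordinal (lt_nth i)).
  move=> i j [] /eqP; rewrite nth_uniq ?ssz ?ltn_ord ?(perm_uniq sn) ?iota_uniq //.
  by move/eqP/val_inj.
exists (perm inj); apply: (@eq_from_nth _ 0) => [|i]; rewrite size_word ?ssz // => lt_in.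
by rewrite (nth_word _ (Ordinal lt_in)) permE.
Qed.

Lemma word_tperm v (a b : 'I_n) : word (v * tperm a b) = map (exchange a b) (word v).
Proof.
rewrite /word -map_comp; apply: eq_map => i /=; rewrite permM /exchange !val_eqE.
by case: tpermP => [-> | -> | /eqP/negPf-> /eqP/negPf->]; rewrite ?eqxx //; case: eqP => [->|].
Qed.

Lemma word1 : word 1 = iota 0 n.
Proof. by rewrite -val_enum_ord; apply: eq_map => i; rewrite perm1. Qed.

Lemma inv_nth (s : seq nat) :
  inv s = \sum_(i < size s) \sum_(j < size s) ((i < j) && (nth 0 s j < nth 0 s i)).
Proof.
elim: s => [|x s IHs] /=; first by rewrite big_ord0.
rewrite !big_ord_recl /= add0n IHs; congr (_ + _).
  by rewrite -sum1_count big_mkcond (big_nth 0) big_mkord; apply: eq_bigr => i _; case: ltP.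
apply: eq_bigr => i _; rewrite big_ord_recl /= add0n.
by apply: eq_bigr => j _; rewrite /bump !add1n ltnS.
Qed.

Lemma perm_lengthE v : perm_length v = inv (word v).
Proof.
rewrite inv_nth size_word pair_big /= /perm_length cardsE -sum1_card big_mkcond.
by apply: eq_bigr => -[i j] _; rewrite !nth_word /in_mem /=; case: ifP.
Qed.

End Words.

Section WordInduction.

Lemma adjacent_descent (w : seq nat) : uniq w -> ~~ sorted ltn w ->
  exists A i j B, w = A ++ j :: i :: B /\ i < j.
Proof.
case: w => //= x w; elim: w x => //= y w IHw x /andP[xw yw].
rewrite negb_and; case: ltnP => [_ /= /(IHw y yw)[A [i [j [B [-> ij]]]]] | yx _].
  by exists (x :: A), i, j, B.
exists [::], y, x, w; split=> //; rewrite ltn_neqAle yx andbT.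
by apply: contraNneq xw => ->; rewrite mem_head.
Qed.

Lemma word_ind (V : seq nat) (Q : seq nat -> Prop) : sorted ltn V -> Q V ->
    (forall A i j B, perm_eq (A ++ i :: j :: B) V -> i < j ->
      Q (A ++ i :: j :: B) -> Q (A ++ j :: i :: B)) ->
  forall w, perm_eq w V -> Q w.
Proof.
move=> sV QV Qstep w; have [k] := ubnP (inv w); elim: k w => // k IHk w ltk wV.
have uw : uniq w by rewrite (perm_uniq wV) (sorted_uniq ltn_trans ltnn).
have [sw | /(adjacent_descent uw)[A [i [j [B [Ew ij]]]]]] := boolP (sorted ltn w).
  by rewrite (irr_sorted_eq ltn_trans ltnn sw sV (perm_mem wV)).
have wV' : perm_eq (A ++ i :: j :: B) V.
  by rewrite -(permPr wV) Ew perm_cat2l (perm_catCA [:: i] [:: j]).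
rewrite Ew; apply: Qstep => //; apply: IHk => //.
by move: ltk; rewrite Ew inv_swap.
Qed.

End WordInduction.

Definition swapped (V v x : seq nat) :=
  exists a b, [/\ a \in V, b \in V & x = map (exchange a b) v].

(** Only differences of cardinalities are prescribed: complements are taken in [P], which may have
    more elements than there are join-irreducibles, and the record must survive them. *)
Record middle_fun (P : finType) (V : seq nat) (f : seq nat -> {set P}) : Prop := MiddleFun {
  middle_fun_card : forall v w, perm_eq v V -> perm_eq w V -> #|f v| + inv w = #|f w| + inv v;
  middle_fun_up : forall A i j B, perm_eq (A ++ i :: j :: B) V -> i < j ->
    f (A ++ i :: j :: B) \subset f (A ++ j :: i :: B);
  middle_fun_inj : forall v w, perm_eq v V -> perm_eq w V -> f v = f w -> v = w;
  middle_fun_cup : forall v w, perm_eq v V -> perm_eq w V ->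
    exists2 x, perm_eq x V & f x = f v :|: f w;
  middle_fun_cap : forall v w, perm_eq v V -> perm_eq w V ->
    exists2 x, perm_eq x V & f x = f v :&: f w;
  middle_fun_cover : forall v x, perm_eq v V -> perm_eq x V -> f v \subset f x ->
    inv x = (inv v).+1 -> swapped V v x }.

(** * The set-valued function of a middle order *)

Section MiddleOrderFun.

Import GroupScope.

Variables (n : nat) (r : rel 'S_n).
Hypothesis hr : middle_order r.
Implicit Types v w x : 'S_n.

Lemma bruhat_lengthP v w : bruhat_le v w -> v = w \/ perm_length v < perm_length w.
Proof.
case/connectP=> p; elim: p v => [|z p IHp] v /=; first by move=> _ ->; left.
case/andP=> /andP[_ vz] pth lst; right.
by case: (IHp z pth lst) => [<- // | ]; apply: ltn_trans.
Qed.

(** Every Bruhat step raises the length, so only one step fits. *)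
Lemma bruhat_cover v w : bruhat_le v w -> perm_length w = (perm_length v).+1 ->
  exists a b, w = v * tperm a b.
Proof.
case/connectP=> -[|z p] /= => [_ -> /eqP|]; first by rewrite ltn_eqF.
case/andP=> /andP[/existsP[a /existsP[b /eqP vz]] lvz] pth lst Elw.
exists a, b; rewrite -vz.
have /bruhat_lengthP[-> // | ] : bruhat_le z w by apply/connectP; exists p.
by rewrite Elw ltnS leqNgt lvz.
Qed.

Lemma word_split v A (i j : nat) B : word v = A ++ i :: j :: B ->
  exists a b : 'I_n, [/\ val a = i, val b = j & v^-1 b = (v^-1 a).+1 :> nat].
Proof.
move=> Ev; have szE : n = size A + (size B).+2 by rewrite -(size_word v) Ev size_cat.
have An : size A < n by lia.
have An1 : (size A).+1 < n by lia.
exists (v (Ordinal An)), (v (Ordinal An1)); split; rewrite ?permK //.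
  by rewrite -[LHS]nth_word Ev /= nth_cat ltnn subnn.
by rewrite -[LHS]nth_word Ev /= nth_cat ltnNge leqnSn subSnn.
Qed.

Lemma tperm_positions (P : 'I_n -> nat) (a b x y : 'I_n) :
    injective P -> a < b -> P b = (P a).+1 -> x < y -> P y < P x ->
  P (tperm a b y) < P (tperm a b x).
Proof.
move=> Pinj ab adj xy.
have posI (s t : 'I_n) : s <> t -> P s != P t by move=> st; apply/eqP => /Pinj.
case: (tpermP a b y) => [Ey | Ey | nya nyb]; case: (tpermP a b x) => [Ex | Ex | nxa nxb];
  try move: (posI _ _ nxa) (posI _ _ nxb); try move: (posI _ _ nya) (posI _ _ nyb);
  move: xy; rewrite ?Ex ?Ey ?adj; lia.
Qed.

Lemma right_weak_adjacent v (a b : 'I_n) : a < b -> v^-1 b = (v^-1 a).+1 :> nat ->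
  right_weak_le v (v * tperm a b).
Proof.
move=> ab adj x y xy; rewrite /before invMg !permM tpermV.
apply: (@tperm_positions (fun i => nat_of_ord (v^-1 i))) => //.
by move=> s t /val_inj/perm_inj.
Qed.

Let r1 : forall v, r 1 v.
Proof.
case: hr => _ wr _ v; apply: wr => i j ij; rewrite /before invg1 !perm1.
by rewrite ltnNge ltnW.
Qed.

Theorem middle_order_fun : exists (f : seq nat -> {set 'S_n}),
  [/\ middle_fun (iota 0 n) f, f (iota 0 n) = set0
    & forall v w, r v w = (f (word v) \subset f (word w))].
Proof.
case: (hr) => dl wr rb.
have [meet [join [[r_refl r_trans r_anti] [r_meet r_join meetUr]]]] := distr_lattice_ops dl.
pose I v := irreducibles_below r join v.
have IE v w : (I v \subset I w) = r v w by apply: (irreducibles_below_subset r_refl).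
(* The union has a single term when [s] is the word of a permutation, and none otherwise. *)
pose f s := \bigcup_(v : 'S_n | word v == s) I v.
have fE v : f (word v) = I v.
  rewrite /f (bigD1 v) //= big1 ?setU0 // => w /andP[/eqP/word_inj ->].
  by rewrite eqxx.
have perm_length_lt v w : r v w -> v <> w -> perm_length v < perm_length w.
  by move=> /rb/bruhat_lengthP[].
have adjacent v A (i j : nat) B : word v = A ++ i :: j :: B -> i < j ->
    exists w, [/\ word w = A ++ j :: i :: B, r v w & #|I w| = #|I v|.+1].
  move=> Ev ij; have [a [b [Ea Eb adj]]] := word_split Ev.
  have ab : a < b by rewrite -Ea -Eb in ij.
  have uv := word_uniq v.
  have Ew : word (v * tperm a b) = A ++ j :: i :: B.
    rewrite word_tperm Ev map_cat /= -Ea -Eb exchangel exchanger.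
    move: uv; rewrite Ev cat_uniq /= -Ea -Eb ?inE !negb_or.
    case/and5P=> _ /and3P[aA bA _] /andP[_ aB] bB _.
    by rewrite !map_exchange_id.
  have lvw : perm_length (v * tperm a b) = (perm_length v).+1.
    by rewrite !perm_lengthE Ew Ev inv_swap.
  have rvw : r v (v * tperm a b) by apply/wr/right_weak_adjacent.
  have nvw : v != v * tperm a b.
    by apply/eqP => /(congr1 (@perm_length n)); rewrite lvw; lia.
  exists (v * tperm a b); split=> //.
  have sub : I v \subset I (v * tperm a b) by rewrite IE.
  rewrite -(cardsID (I v)) (setIidPr sub) (card_irreducibles_cover r_refl r_trans r_anti r_meet r_join meetUr) ?addn1 //.
  (* An adjacent swap is a cover: an element strictly between would have a length strictly between
     two consecutive integers. *)
  move=> z vz zw; have [-> | /eqP nvz] := eqVneq v z; first by left.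
  have [-> | /eqP nzw] := eqVneq z (v * tperm a b); first by right.
  by move: (perm_length_lt _ _ vz nvz) (perm_length_lt _ _ zw nzw); rewrite lvw; lia.
have I1 : I 1 = set0 by exact: (irreducibles_below_bottom _ r_trans r1).
have cardI v : #|I v| = inv (word v).
  have fcard s : perm_eq s (iota 0 n) -> #|f s| = inv s.
    apply: (@word_ind _ (fun s => #|f s| = inv s)); first exact: iota_ltn_sorted.
      by rewrite -word1 fE I1 cards0 word1 inv_sorted ?iota_ltn_sorted.
    move=> A i j B /word_surj[u Eu] ij; have [w [Ew _ cw]] := adjacent _ _ _ _ _ Eu ij.
    by rewrite -Eu fE -Ew fE cw Ew Eu inv_swap // => ->.
  by rewrite -fE fcard ?perm_word.
exists f; split; last by move=> v w; rewrite !fE IE.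
  split.
  - by move=> ? ? /word_surj[v <-] /word_surj[w <-]; rewrite !fE !cardI addnC.
  - move=> A i j B /word_surj[v Ev] ij; have [w [Ew vw _]] := adjacent _ _ _ _ _ Ev ij.
    by rewrite -Ev -Ew !fE IE.
  - move=> ? ? /word_surj[v <-] /word_surj[w <-]; rewrite !fE => E; congr word.
    by apply: r_anti; rewrite -!IE E subxx.
  - move=> ? ? /word_surj[v <-] /word_surj[w <-]; exists (word (join v w)); rewrite ?perm_word //.
    by rewrite !fE; apply: (irreducibles_below_join r_refl r_trans r_anti r_meet r_join meetUr).
  - move=> ? ? /word_surj[v <-] /word_surj[w <-]; exists (word (meet v w)); rewrite ?perm_word //.
    by rewrite !fE; apply: (irreducibles_below_meet _ r_meet).
  move=> ? ? /word_surj[v <-] /word_surj[x <-]; rewrite !fE IE => vx.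
  rewrite -!perm_lengthE => /(bruhat_cover (rb _ _ vx))[a [b ->]].
  by exists (val a), (val b); rewrite word_tperm; split=> //; rewrite mem_iota /= add0n.
by rewrite -word1 fE.
Qed.

End MiddleOrderFun.

(** * Four letters *)

(* Hides an implication from [congruence], which would try to instantiate it.    *)
Definition forces (U : Type) (a b c d : U) := a = b -> c = d.

Section FourLetters.

(* [Lij s t] stands for the label of the step exchanging [i] and [j]; the flags  *)
(* tell which of the two other letters, in increasing order, are on its left.    *)
(* [tijk s] is the type of the hexagon on [i < j < k] when the fourth letter is  *)
(* on its left ([s]) or on its right.  The hypotheses [N1], ..., [N7] compare    *)
(* steps of one maximal chain, and [E1], ..., [E6] come from joins and meets.    *)
Variables (U : Type) (L12 L13 L14 L23 L24 L34 : bool -> bool -> U).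
Variables t123 t124 t134 t234 : bool -> bool.
Hypothesis H123 : forall s, if t123 s
  then [/\ L23 false s = L23 true s, L12 false s = L13 false s & L12 true s = L13 true s]
  else [/\ L12 false s = L12 true s, L13 true s = L23 true s & L13 false s = L23 false s].
Hypothesis H124 : forall s, if t124 s
  then [/\ L24 false s = L24 true s, L12 s false = L14 false s & L12 s true = L14 true s]
  else [/\ L12 s false = L12 s true, L14 true s = L24 true s & L14 false s = L24 false s].
Hypothesis H134 : forall s, if t134 s
  then [/\ L34 false s = L34 true s, L13 s false = L14 s false & L13 s true = L14 s true]
  else [/\ L13 s false = L13 s true, L14 s true = L34 true s & L14 s false = L34 false s].
Hypothesis H234 : forall s, if t234 s
  then [/\ L34 s false = L34 s true, L23 s false = L24 s false & L23 s true = L24 s true]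
  else [/\ L23 s false = L23 s true, L24 s true = L34 s true & L24 s false = L34 s false].
Hypothesis N1 : L34 true false <> L12 true true.
Hypothesis N2 : L34 false true <> L23 false true.
Hypothesis N3 : L23 true false <> L14 false false.
Hypothesis N4 : L23 true false <> L13 false true.
Hypothesis N5 : L23 true false <> L14 true true.
Hypothesis N6 : L14 false false <> L13 false true.
Hypothesis N7 : L14 true true <> L24 false true.
Hypothesis E1 : forces (L24 true false) (L23 true false) (L13 false false) (L14 false false).
Hypothesis E2 : forces (L23 false true) (L24 false true) (L13 true true) (L14 true true).
Hypothesis E3 : forces (L13 true false) (L23 true false) (L24 true true) (L14 true true).
Hypothesis E4 : forces (L13 false true) (L23 false true) (L24 false false) (L14 false false).
Hypothesis E5 : forces (L13 true false) (L24 true false) (L23 true false) (L24 true false).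
Hypothesis E6 : forces (L24 false true) (L13 false true) (L23 false true) (L24 false true).

(** For each of the 256 assignments of types, all hypotheses become equalities, inequalities and
    implications between equalities of labels, which congruence closure can handle. *)
Lemma four_letters :
  [/\ forall s, t123 s = t123 false, forall s, t124 s = t124 false,
      forall s, t134 s = t134 false & forall s, t234 s = t234 false] /\
  (t123 false, t124 false, t134 false, t234 false) \in
    [:: (false, false, false, false); (false, false, true, true);
        (true, false, false, false); (true, true, true, false);
        (true, true, true, true)].
Proof.
move: (H123 false) (H123 true) (H124 false) (H124 true)
  (H134 false) (H134 true) (H234 false) (H234 true).
case E123: (t123 false); case E123': (t123 true);
case E124: (t124 false); case E124': (t124 true);
case E134: (t134 false); case E134': (t134 true);
case E234: (t234 false); case E234': (t234 true);
case=> ? ? ?; case=> ? ? ?; case=> ? ? ?; case=> ? ? ?;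
case=> ? ? ?; case=> ? ? ?; case=> ? ? ?; case=> ? ? ?;
(* The assignments left by the conclusion are closed first. In the others, each [forces] whose
   premise follows from the known equalities releases its conclusion, until a contradiction
   appears. *)
try (by split; [split; case|]); exfalso;
repeat first [congruence
  | match goal with H : forces _ _ _ _ |- _ =>
    unfold forces in H; specialize (H ltac:(congruence)) end].
Qed.
End FourLetters.

Ltac solve_perm H :=
  apply: perm_trans H; apply/seq.permP => ?;
  rewrite /= -?catA /= ?count_cat /= ?count_cat /= ?count_cat /=; clear; lia.

Ltac count_perm := apply/seq.permP => ?;
  rewrite /= -?catA /= ?count_cat /= ?count_cat /= ?count_cat /= ?count_cat /=; clear; lia.

(** * Squares of sets *)

Section SetDiamond.
Variables (P : finType) (A B1 B2 C : {set P}).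
Hypotheses (AB1 : A \subset B1) (AB2 : A \subset B2) (B1C : B1 \subset C) (B2C : B2 \subset C).
Hypotheses (cB1 : #|B1| = #|A|.+1) (cB2 : #|B2| = #|A|.+1) (cC : #|C| = #|A|.+2).
Hypothesis B12 : B1 <> B2.

Lemma set_diamond : B1 :&: B2 = A /\ B1 :|: B2 = C.
Proof.
have sub : A \subset B1 :&: B2 by rewrite subsetI AB1.
have lt : #|B1 :&: B2| < #|B1|.
  rewrite ltnNge; apply/negP => le.
  have /setIidPl B12s : B1 :&: B2 = B1 by apply/eqP; rewrite eqEcard subsetIl.
  by apply: B12; apply/eqP; rewrite eqEcard B12s cB1 cB2 leqnn.
have IA : B1 :&: B2 = A by apply/esym/eqP; rewrite eqEcard sub -ltnS -cB1.
split=> //; apply/eqP; rewrite eqEcard subUset B1C B2C /=.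
by rewrite cC cardsU IA cB1 cB2; lia.
Qed.

Lemma set_diamondl : B1 :\: A = C :\: B2.
Proof.
case: set_diamond => <- <-; apply/setP => x; rewrite !inE.
by case: (x \in B1); case: (x \in B2).
Qed.

Lemma set_diamondr : B2 :\: A = C :\: B1.
Proof.
case: set_diamond => <- <-; apply/setP => x; rewrite !inE.
by case: (x \in B1); case: (x \in B2).
Qed.
End SetDiamond.

(** * Words that are one exchange of letters away from two given words *)

Section Exchanges.

Lemma exchange_unique p q s t : exchange p q s = t -> s != t -> exchange p q =1 exchange s t.
Proof.
move=> E nst x; have [Es | nsp] := eqVneq s p.
  by rewrite -E Es exchangel.
have [Es | nsq] := eqVneq s q.
  by rewrite -E Es exchanger exchangeC.
by case/eqP: nst; rewrite -E exchange_id.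
Qed.

Lemma map_id_in (h : nat -> nat) (s : seq nat) : (forall z, z \in s -> h z = z) -> map h s = s.
Proof. by move=> hz; rewrite -[RHS]map_id; apply/eq_in_map. Qed.

(** The two given words differ by a 3-cycle of letters. Two transpositions whose product is a
    3-cycle move only its three letters, which leaves three choices for the first one. *)
Lemma swapped_cycle (V A B C D : seq nat) a b c x :
    uniq (A ++ a :: B ++ b :: C ++ c :: D) ->
    perm_eq (A ++ a :: B ++ b :: C ++ c :: D) V ->
    swapped V (A ++ a :: B ++ b :: C ++ c :: D) x ->
    swapped V (A ++ b :: B ++ c :: C ++ a :: D) x ->
  [\/ x = A ++ b :: B ++ a :: C ++ c :: D, x = A ++ a :: B ++ c :: C ++ b :: D
    | x = A ++ c :: B ++ b :: C ++ a :: D].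
Proof.
set v := A ++ _ => uv vV [p [q [pV qV Ex]]] [p' [q' [_ _ Ex']]].
have : uniq ([:: a; b; c] ++ (A ++ B ++ C ++ D)).
  by rewrite -(perm_uniq (_ : perm_eq v _)) // /v; count_perm.
rewrite cat_uniq /= !inE !negb_or => /and3P[/and3P[/andP[nab nac] nbc _] /hasPn dis _].
have notin z : z \in A ++ B ++ C ++ D -> [/\ z != a, z != b & z != c].
  by move/dis; rewrite !inE !negb_or => /and3P.
have fixed h : (forall z, z != a -> z != b -> z != c -> h z = z) ->
    [/\ map h A = A, map h B = B, map h C = C & map h D = D].
  by move=> hz; split; apply: map_id_in => y ys; have [] := notin y _;
    rewrite ?mem_cat ?ys ?orbT //; apply: hz.
pose rot z := if z == a then b else if z == b then c else if z == c then a else z.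
have [rota rotb rotc] : [/\ rot a = b, rot b = c & rot c = a].
  by rewrite /rot !eqxx ![_ == a]eq_sym ![c == _]eq_sym (negPf nab) (negPf nac) (negPf nbc).
have rotE z : z \in v -> exchange p q z = exchange p' q' (rot z).
  have Ew : map rot v = A ++ b :: B ++ c :: C ++ a :: D.
    have [|hA hB hC hD] := fixed rot.
      by move=> y; rewrite /rot => /negPf-> /negPf-> /negPf->.
    by rewrite /v !(map_cat, map_cons) hA hB hC hD rota rotb rotc.
  rewrite -Ew -map_comp Ex in Ex'; move=> zv.
  by move/eq_in_map: Ex' => /(_ z zv).
have [av bv cv] : [/\ a \in v, b \in v & c \in v].
  by rewrite /v !(mem_cat, inE) !eqxx ?orbT.
have npq : p != q.
  apply: contraNneq nbc => Epq; have t1 z : exchange p q z = z by rewrite /exchange Epq; case: eqP.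
  move: (rotE a av) (rotE b bv) (rotE c cv); rewrite !t1 rota rotb rotc => Ea Eb Ec.
  by apply/eqP; rewrite [RHS]Ec [in RHS]Ea exchangeK.
have moved s t : s \in v -> s != t -> exchange p q =1 exchange s t ->
    [\/ s = a, s = b | s = c].
  move=> sv nst Est; have [-> | nsa] := eqVneq s a; first by constructor 1.
  have [-> | nsb] := eqVneq s b; first by constructor 2.
  have [-> | nsc] := eqVneq s c; first by constructor 3.
  have rots : rot s = s by rewrite /rot (negPf nsa) (negPf nsb) (negPf nsc).
  have := rotE s sv; rewrite Est exchangel rots => /esym/exchange_unique/(_ nst) Est'.
  have := rotE a av; rewrite Est Est' rota => /(inv_inj (exchangeK s t)) Eab.
  by rewrite Eab eqxx in nab.
have pv : p \in v by rewrite (perm_mem vV).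
have qv : q \in v by rewrite (perm_mem vV).
have pP := moved p q pv npq (fun=> erefl).
have qP : [\/ q = a, q = b | q = c].
  by apply: moved (exchangeC p q); rewrite // eq_sym.
have [] := fixed (exchange p q); last first.
  move=> hA hB hC hD; rewrite Ex /v !(map_cat, map_cons) hA hB hC hD.
  have [nba nca ncb] : [/\ b != a, c != a & c != b] by split; rewrite eq_sym.
  case: pP => Ep; case: qP => Eq; move: npq; rewrite Ep Eq ?eqxx // => _;
    rewrite ?exchangel ?exchanger ?exchange_id //;
      by [constructor 1 | constructor 2 | constructor 3].
move=> z za zb zc; apply: exchange_id.
  by case: pP => ->.
by case: qP => ->.
Qed.

(** Here the words differ by a double transposition, and two transpositions with this product are
    its two factors, in either order. *)
Lemma swapped_double (V A E : seq nat) a b c d x :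
    uniq (A ++ [:: a, b, c, d & E]) -> perm_eq (A ++ [:: a, b, c, d & E]) V ->
    swapped V (A ++ [:: a, b, c, d & E]) x -> swapped V (A ++ [:: c, d, a, b & E]) x ->
  x = A ++ [:: c, b, a, d & E] \/ x = A ++ [:: a, d, c, b & E].
Proof.
set v := A ++ _ => uv vV [p [q [pV qV Ex]]] [p' [q' [_ _ Ex']]].
have : uniq ([:: a; b; c; d] ++ (A ++ E)).
  by rewrite -(perm_uniq (_ : perm_eq v _)) // /v; count_perm.
rewrite cat_uniq /= !inE !negb_or => /and3P[/and4P[/and3P[nab nac nad] /andP[nbc nbd] ncd _] /hasPn dis _].
have notin z : z \in A ++ E -> [/\ z != a, z != b, z != c & z != d].
  by move/dis; rewrite !inE !negb_or => /and4P.
have fixed h : (forall z, z != a -> z != b -> z != c -> z != d -> h z = z) ->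
    map h A = A /\ map h E = E.
  by move=> hz; split; apply: map_id_in => y ys; have [] := notin y _;
    rewrite ?mem_cat ?ys ?orbT //; apply: hz.
pose flip := exchange a c \o exchange b d.
have [[nba nca nda] [ncb ndb ndc]] : [/\ b != a, c != a & d != a] /\ [/\ c != b, d != b & d != c].
  by split; split; rewrite eq_sym.
have [flipa flipb flipc flipd] : [/\ flip a = c, flip b = d, flip c = a & flip d = b].
  rewrite /flip /= exchangel exchanger (@exchange_id b d a) // (@exchange_id b d c) //.
  by rewrite exchangel exchanger !(@exchange_id a c).
have flipE z : z \in v -> exchange p q z = exchange p' q' (flip z).
  have Ew : map flip v = A ++ [:: c, d, a, b & E].
    have [|hA hE] := fixed flip.
      by move=> y ya yb yc yd; rewrite /flip /= !exchange_id.
    by rewrite /v !(map_cat, map_cons) hA hE flipa flipb flipc flipd.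
  rewrite -Ew -map_comp Ex in Ex'; move=> zv.
  by move/eq_in_map: Ex' => /(_ z zv).
have [av bv cv dv] : [/\ a \in v, b \in v, c \in v & d \in v].
  by rewrite /v !(mem_cat, inE) !eqxx ?orbT.
have npq : p != q.
  apply: contraNneq ncd => Epq; have t1 z : exchange p q z = z by rewrite /exchange Epq; case: eqP.
  move: (flipE b bv) (flipE c cv) (flipE d dv); rewrite !t1 flipb flipc flipd => Eb Ec Ed.
  move: Eb nbd => /esym/exchange_unique/(_ _) Eb; rewrite eq_sym => /Eb Et.
  by move: (flipE a av) nac; rewrite !t1 flipa Et exchange_id ?eqxx // eq_sym // => <-;
    rewrite eqxx.
have pv : p \in v by rewrite (perm_mem vV).
have qv : q \in v by rewrite (perm_mem vV).
have flip_moves z : z \in [:: a; b; c; d] -> flip z != z /\ flip (flip z) = z.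
  rewrite !inE => /or4P[] /eqP->; rewrite ?flipa ?flipb ?flipc ?flipd ?flipa ?flipb ?flipc ?flipd;
    by rewrite // eq_sym.
have pin : p \in [:: a; b; c; d].
  apply: contraT; rewrite !inE !negb_or => /and4P[npa npb npc npd].
  have flipp : flip p = p by rewrite /flip /= !exchange_id.
  have := flipE p pv; rewrite exchangel flipp => /esym/exchange_unique/(_ npq) Et.
  have := flipE a av; rewrite Et flipa => /(inv_inj (exchangeK p q)) Eac.
  by rewrite Eac eqxx in nac.
have qE : q = flip p.
  have [nfp fK] := flip_moves p pin; apply/eqP; apply: contraT => nqf.
  have := flipE p pv; rewrite exchangel => /esym/exchange_unique; rewrite eq_sym => /(_ nqf) Et.
  have Ep : exchange p' q' p = p by rewrite Et exchange_id // eq_sym.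
  have := flipE q qv; rewrite exchanger -{1}Ep => /(inv_inj (exchangeK p' q')) Epf.
  have [qin | ] := boolP (q \in [:: a; b; c; d]).
    by move: nqf; rewrite Epf (flip_moves q qin).2 eqxx.
  rewrite !inE !negb_or => /and4P[nqa nqb nqc nqd].
  by move: npq; rewrite Epf /flip /= !exchange_id // eqxx.
have [] := fixed (exchange p q).
  move=> z za zb zc zd; apply: exchange_id; move: pin; rewrite ?qE !inE => /or4P[] /eqP->;
    rewrite ?flipa ?flipb ?flipc ?flipd //.
move=> hA hE; rewrite Ex /v !(map_cat, map_cons) hA hE qE.
move: pin; rewrite !inE => /or4P[] /eqP->; rewrite ?flipa ?flipb ?flipc ?flipd
  ?exchangel ?exchanger ?exchange_id //; try by rewrite eq_sym.
- by left.
- by right.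
- by left.
- by right.
Qed.
End Exchanges.

(** * Labels and hexagons *)

Section Labels.

Variables (P : finType) (V : seq nat) (f : seq nat -> {set P}).
Implicit Types A B C D : seq nat.

Definition label A i j B : {set P} := f (A ++ j :: i :: B) :\: f (A ++ i :: j :: B).

(* The two possible shapes of the hexagon of [i < j < k]: the join of its two  *)
(* elements covering [A i j k B] is [A j k i B] (false) or [A k i j B] (true). *)
Definition hexagon (b : bool) A i j k B : Prop :=
  if b then [/\ label A j k (i :: B) = label (i :: A) j k B,
                label A i j (k :: B) = label A i k (j :: B)
              & label (k :: A) i j B = label (j :: A) i k B]
  else [/\ label A i j (k :: B) = label (k :: A) i j B,
           label (j :: A) i k B = label (i :: A) j k B
         & label A i k (j :: B) = label A j k (i :: B)].

(** Decides whether the equations of the shape [false] fail; that the shape [true] then holds is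
    [hexagonP]. *)
Definition hexagon_type A i j k B : bool :=
  ~~ [&& label A i j (k :: B) == label (k :: A) i j B,
         label (j :: A) i k B == label (i :: A) j k B
       & label A i k (j :: B) == label A j k (i :: B)].

Hypothesis hf : middle_fun V f.

Let is_word w := perm_eq w V.

Lemma middle_fun_step A i j B : is_word (A ++ i :: j :: B) -> i < j ->
  [/\ is_word (A ++ j :: i :: B), f (A ++ i :: j :: B) \subset f (A ++ j :: i :: B)
    & #|f (A ++ j :: i :: B)| = #|f (A ++ i :: j :: B)|.+1].
Proof.
move=> W ij; have W' : is_word (A ++ j :: i :: B) by solve_perm W.
split=> //; first exact: (middle_fun_up hf).
by have := middle_fun_card hf W W'; rewrite inv_swap //; clear; lia.
Qed.

Lemma card_label A i j B : is_word (A ++ i :: j :: B) -> i < j -> #|label A i j B| = 1.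
Proof.
by move=> W ij; have [_ /setIidPr sub cc] := middle_fun_step W ij; rewrite cardsD sub cc subSnn.
Qed.

Lemma label_diamond u v w t : is_word u -> is_word v -> is_word w -> is_word t ->
    f u \subset f v -> f u \subset f w -> f v \subset f t -> f w \subset f t ->
    inv v = (inv u).+1 -> inv w = (inv u).+1 -> inv t = (inv u).+2 -> v != w ->
  f v :\: f u = f t :\: f w /\ f w :\: f u = f t :\: f v.
Proof.
move=> Wu Wv Ww Wt uv uw vt wt iv iw it nvw.
have cv := middle_fun_card hf Wu Wv; have cw := middle_fun_card hf Wu Ww.
have ct := middle_fun_card hf Wu Wt.
have nf : f v <> f w by move/(middle_fun_inj hf Wv Ww)/eqP; rewrite (negPf nvw).
have [cv' [cw' ct']] : #|f v| = #|f u|.+1 /\ #|f w| = #|f u|.+1 /\ #|f t| = #|f u|.+2.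
  by move: cv cw ct; rewrite iv iw it; clear; lia.
by split; [apply: set_diamondl | apply: set_diamondr].
Qed.

Lemma middle_fun_step_inv A i j B : is_word (A ++ i :: j :: B) -> i < j ->
  f (A ++ i :: j :: B) \subset f (A ++ j :: i :: B) /\
  inv (A ++ j :: i :: B) = (inv (A ++ i :: j :: B)).+1.
Proof. by move=> W ij; rewrite inv_swap //; split=> //; apply: (middle_fun_up hf). Qed.

(** Two adjacent swaps at disjoint places span a square of words, and opposite sides of a square
    carry the same label. *)
Lemma label_squarel A k l C i j B : is_word (A ++ k :: l :: C ++ i :: j :: B) -> i < j -> k < l ->
  label (A ++ k :: l :: C) i j B = label (A ++ l :: k :: C) i j B.
Proof.
move=> W ij kl; rewrite /label -!catA /=.
set u := A ++ k :: l :: C ++ i :: j :: B.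
set v := A ++ k :: l :: C ++ j :: i :: B.
set w := A ++ l :: k :: C ++ i :: j :: B.
set t := A ++ l :: k :: C ++ j :: i :: B.
have Wv : is_word v by solve_perm W.
have Ww : is_word w by solve_perm W.
have Wt : is_word t by solve_perm W.
have Ew : f u \subset f w /\ inv w = (inv u).+1.
  exact: middle_fun_step_inv.
have Et : f v \subset f t /\ inv t = (inv v).+1.
  exact: middle_fun_step_inv.
have Ev : f u \subset f v /\ inv v = (inv u).+1.
  by have := @middle_fun_step_inv (A ++ k :: l :: C) i j B; rewrite -!catA; apply.
have Et' : f w \subset f t.
  by have := @middle_fun_up _ _ _ hf (A ++ l :: k :: C) i j B; rewrite -!catA; apply.
case: Ew Et Ev => uw iw [vt it] [uv iv].
have nvw : v != w.
  by apply/eqP => /eqP; rewrite eqseq_cat // eqxx /= eqseq_cons (ltn_eqF kl).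
by case: (@label_diamond u v w t) => //; rewrite it ?iv ?iw.
Qed.

Lemma label_squarer A i j C k l B : is_word (A ++ i :: j :: C ++ k :: l :: B) -> i < j -> k < l ->
  label A i j (C ++ k :: l :: B) = label A i j (C ++ l :: k :: B).
Proof.
move=> W ij kl; rewrite /label.
set u := A ++ i :: j :: C ++ k :: l :: B.
set v := A ++ j :: i :: C ++ k :: l :: B.
set w := A ++ i :: j :: C ++ l :: k :: B.
set t := A ++ j :: i :: C ++ l :: k :: B.
have Wv : is_word v by solve_perm W.
have Ww : is_word w by solve_perm W.
have Wt : is_word t by solve_perm W.
have Ev : f u \subset f v /\ inv v = (inv u).+1.
  exact: middle_fun_step_inv.
have Et : f w \subset f t /\ inv t = (inv w).+1.
  exact: middle_fun_step_inv.
have Ew : f u \subset f w /\ inv w = (inv u).+1.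
  by have := @middle_fun_step_inv (A ++ i :: j :: C) k l B; rewrite -!catA; apply.
have Et' : f v \subset f t.
  by have := @middle_fun_up _ _ _ hf (A ++ j :: i :: C) k l B; rewrite -!catA; apply.
case: Ev Et Ew => uv iv [wt it] [uw iw].
have nvw : v != w.
  by apply/eqP => /eqP; rewrite eqseq_cat // eqxx /= eqseq_cons (gtn_eqF ij).
by case: (@label_diamond u v w t) => //; rewrite it ?iv ?iw.
Qed.

Lemma eq_perm_adjacent (U : Type) (h : seq nat -> U) (s0 : seq nat) :
    (forall A a b B, perm_eq (A ++ a :: b :: B) s0 ->
      h (A ++ a :: b :: B) = h (A ++ b :: a :: B)) ->
  forall s t, perm_eq s s0 -> perm_eq t s0 -> h s = h t.
Proof.
move=> hadj s t ss0 ts0.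
have {ts0} : perm_eq s t by rewrite (perm_trans ss0) // perm_sym.
have {ss0 hadj} : forall A a b B, perm_eq (A ++ a :: b :: B) s ->
  h (A ++ a :: b :: B) = h (A ++ b :: a :: B).
  by move=> A a b B /perm_trans/(_ ss0); apply: hadj.
elim: s t h => [|x s IHs] t h hadj st.
  by move: st; rewrite perm_sym => /perm_nilP->.
have xt : x \in t by rewrite -(perm_mem st) mem_head.
case/splitPr: xt st => t1 t2 st.
have {}st : perm_eq s (t1 ++ t2) by rewrite -(perm_cons x) (perm_trans st) // (perm_catCA t1 [:: x]).
have front C : forall B, perm_eq (C ++ x :: B) (x :: s) -> h (C ++ x :: B) = h (x :: C ++ B).
  elim/last_ind: C => // C c IHC B; rewrite !cat_rcons => CB.
  rewrite hadj // IHC //; apply: perm_trans CB.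
  by rewrite perm_cat2l (perm_catCA [:: x] [:: c]).
rewrite front; last by rewrite (perm_catCA t1 [:: x]) perm_cons perm_sym.
apply: (IHs _ (fun w => h (x :: w))) => // A a b B ss.
by apply: (hadj (x :: A)); rewrite /= perm_cons.
Qed.

Lemma label_perm A A' i j B B' : is_word (A ++ i :: j :: B) -> i < j ->
  perm_eq A' A -> perm_eq B' B -> label A i j B = label A' i j B'.
Proof.
move=> W ij AA BB.
have W' : is_word (A' ++ i :: j :: B) by apply: perm_trans W; rewrite perm_cat2r.
transitivity (label A' i j B).
  apply: (eq_perm_adjacent (h := fun s => label s i j B) (s0 := A)) => // C k l D CD.
  have W2 : is_word (C ++ k :: l :: D ++ i :: j :: B).
    by apply: perm_trans W; rewrite -2!cat_cons catA perm_cat2r.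
  have [kl | lk | -> //] := ltngtP k l; first exact: label_squarel.
  by apply/esym/label_squarel => //; apply: perm_trans W2;
    rewrite perm_cat2l (perm_catCA [:: l] [:: k]).
apply: (eq_perm_adjacent (h := label A' i j) (s0 := B)) => // C k l D CD.
have W2 : is_word (A' ++ i :: j :: C ++ k :: l :: D).
  by apply: perm_trans W'; rewrite perm_cat2l !perm_cons.
have [kl | lk | -> //] := ltngtP k l; first exact: label_squarer.
apply/esym/label_squarer => //; apply: perm_trans W2.
by rewrite perm_cat2l !perm_cons perm_cat2l (perm_catCA [:: l] [:: k]).
Qed.

End Labels.

Lemma inv_context A s t D : perm_eq s t -> inv (A ++ s ++ D) + inv t = inv (A ++ t ++ D) + inv s.
Proof.
move=> st; rewrite !inv_cat (perm_big _ st) /=.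
have -> : \sum_(x <- A) count (fun y => y < x) (s ++ D) = \sum_(x <- A) count (fun y =>
  y < x) (t ++ D).
  by apply: eq_bigr => x _; rewrite !count_cat (seq.permP st).
by move: (\sum_(x <- A) _) (\sum_(x <- t) _) => a b; lia.
Qed.

Section Hexagons.

Variables (P : finType) (V : seq nat) (f : seq nat -> {set P}).
Implicit Types A B C D : seq nat.
Hypotheses (uV : uniq V) (hf : middle_fun V f).
Let is_word w := perm_eq w V.
Notation label := (label f).

Lemma label_cons A k i j B : is_word (A ++ k :: i :: j :: B) -> i < j ->
  label (k :: A) i j B = f (A ++ k :: j :: i :: B) :\: f (A ++ k :: i :: j :: B).
Proof.
move=> W ij; rewrite (@label_perm _ _ _ hf (k :: A) (A ++ [:: k]) i j B B) //.
- by rewrite /label -!catA.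
- by apply: perm_trans W; rewrite -cat1s -catA perm_catCA.
- by rewrite perm_catC.
Qed.

(** The word of the union lies exactly one inversion above both, so the cover condition applies
    twice. This is how a join is turned into an explicit word. *)
Lemma cup_cover v w : is_word v -> is_word w -> v <> w -> inv v = inv w ->
    #|f v :|: f w| <= #|f v|.+1 ->
  exists x, [/\ is_word x, f x = f v :|: f w, inv x = (inv v).+1, swapped V v x & swapped V w x].
Proof.
move=> Wv Ww nvw ivw le.
have [x Wx fx] := middle_fun_cup hf Wv Ww; exists x.
have vx : f v \subset f x by rewrite fx subsetUl.
have wx : f w \subset f x by rewrite fx subsetUr.
have cvw : #|f v| = #|f w| by have := middle_fun_card hf Wv Ww; rewrite ivw; clear; lia.
have lt : #|f v| < #|f x|.
  rewrite ltnNge; apply/negP => xv; apply: nvw; apply: (middle_fun_inj hf) => //.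
  have Evx : f v = f x by apply/eqP; rewrite eqEcard vx.
  by apply/esym/eqP; rewrite eqEcard cvw leqnn andbT Evx.
have ix : inv x = (inv v).+1.
  by move: lt le; rewrite -fx; have := middle_fun_card hf Wv Wx; clear; lia.
by split=> //; apply: (middle_fun_cover hf) => //; rewrite -ivw.
Qed.

Lemma cycle_cup A B C D a b c : is_word (A ++ a :: B ++ b :: C ++ c :: D) ->
    let v := A ++ a :: B ++ b :: C ++ c :: D in
    let w := A ++ b :: B ++ c :: C ++ a :: D in
    a <> b -> inv v = inv w -> #|f v :|: f w| <= #|f v|.+1 ->
  exists x, [/\ is_word x, f x = f v :|: f w, inv x = (inv v).+1 &
    [\/ x = A ++ b :: B ++ a :: C ++ c :: D, x = A ++ a :: B ++ c :: C ++ b :: D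
    | x = A ++ c :: B ++ b :: C ++ a :: D]].
Proof.
move=> Wv v w nab ivw le.
have Ww : is_word w by solve_perm Wv.
have nvw : v <> w by move/eqP; rewrite eqseq_cat // eqseq_cons => /and3P[_ /eqP].
have [x [Wx fx ix vx wx]] := cup_cover Wv Ww nvw ivw le.
exists x; split=> //; apply: swapped_cycle vx wx => //.
by rewrite (perm_uniq Wv).
Qed.

(** The two lower words [j i k] and [i k j] differ by a 3-cycle, and their union has at most one
    more element because both sets contain that of [i j k]. *)
Lemma hexagonP A i j k B : is_word (A ++ i :: j :: k :: B) -> i < j -> j < k ->
  hexagon f (hexagon_type f A i j k B) A i j k B.
Proof.
move=> W ij jk; have ik := ltn_trans ij jk.
suff [hex0 | hex1] : hexagon f false A i j k B \/ hexagon f true A i j k B.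
- rewrite (_ : hexagon_type _ _ _ _ _ _ = false) //; apply/negbTE; rewrite negbK.
  by case: hex0 => /eqP-> /eqP-> /eqP->.
- rewrite /hexagon_type; case: and3P => //= -[/eqP E1 /eqP E2 /eqP E3]; by split.
have W1 : is_word (A ++ j :: i :: k :: B) by solve_perm W.
have W2 : is_word (A ++ i :: k :: j :: B) by solve_perm W.
have W3 : is_word (A ++ j :: k :: i :: B) by solve_perm W.
have W4 : is_word (A ++ k :: i :: j :: B) by solve_perm W.
have W5 : is_word (A ++ k :: j :: i :: B) by solve_perm W.
have step := middle_fun_step_inv hf.
have [s01 i01] := step A i j (k :: B) W ij.
have [s13 i13] : f (A ++ j :: i :: k :: B) \subset f (A ++ j :: k :: i :: B) /\
  inv (A ++ j :: k :: i :: B) = (inv (A ++ j :: i :: k :: B)).+1.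
  by have := step (A ++ [:: j]) i k B; rewrite -!catA; apply.
have [s02 i02] : f (A ++ i :: j :: k :: B) \subset f (A ++ i :: k :: j :: B) /\
  inv (A ++ i :: k :: j :: B) = (inv (A ++ i :: j :: k :: B)).+1.
  by have := step (A ++ [:: i]) j k B; rewrite -!catA; apply.
have [s24 i24] := step A i k (j :: B) W2 ik.
have [s35 i35] := step A j k (i :: B) W3 jk.
have [s45 i45] : f (A ++ k :: i :: j :: B) \subset f (A ++ k :: j :: i :: B) /\
  inv (A ++ k :: j :: i :: B) = (inv (A ++ k :: i :: j :: B)).+1.
  by have := step (A ++ [:: k]) i j B; rewrite -!catA; apply.
have nij : j <> i by move=> E; rewrite E ltnn in ij.
have card12 : #|f (A ++ j :: i :: k :: B) :|: f (A ++ i :: k :: j :: B)| <=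
    #|f (A ++ j :: i :: k :: B)|.+1.
  rewrite cardsU.
  have := subset_leq_card (_ : f (A ++ i :: j :: k :: B) \subset
    f (A ++ j :: i :: k :: B) :&: f (A ++ i :: k :: j :: B)).
  rewrite subsetI s01 s02 => /(_ isT).
  by have := middle_fun_card hf W W2; rewrite i02; clear; lia.
have [x [Wx fx ix]] := @cycle_cup A [::] [::] B j i k W1 nij (etrans i01 (esym i02)) card12.
have n12 : A ++ j :: i :: k :: B != A ++ i :: k :: j :: B.
  by rewrite eqseq_cat // eqseq_cons (gtn_eqF ij) andbF.
have n34 : A ++ j :: k :: i :: B != A ++ k :: i :: j :: B.
  by rewrite eqseq_cat // eqseq_cons (ltn_eqF jk) andbF.
have diamond := label_diamond hf.
rewrite /hexagon.
rewrite !label_cons // /label.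
(* The candidates for the join are [i j k], [j k i] and [k i j]. The first has too few inversions;
   each of the others gives an inclusion that cuts the hexagon into two squares. *)
case=> Ex; rewrite {}Ex in Wx fx ix.
- by move: ix; rewrite i01 => /eqP; rewrite ltn_eqF // ltnS leqnSn.
- left; have s23 : f (A ++ i :: k :: j :: B) \subset f (A ++ j :: k :: i :: B)
  by rewrite fx subsetUr.
  have [e1 e2] := diamond _ _ _ _ W W1 W2 W3 s01 s02 s13 s23 i01 i02 (etrans i13 (congr1 S i01)) n12.
  have i23 : inv (A ++ j :: k :: i :: B) = (inv (A ++ i :: k :: j :: B)).+1.
    by rewrite i13 i01 i02.
  have [e3 e4] := diamond _ _ _ _ W2 W3 W4 W5 s23 s24 s35 s45 i23 i24 (etrans i45 (congr1 S i24)) n34.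
  split; first by rewrite -e3 -e1.
    by rewrite e2.
  by rewrite -e4.
right; have s14 : f (A ++ j :: i :: k :: B) \subset f (A ++ k :: i :: j :: B)
  by rewrite fx subsetUl.
have [e1 e2] := diamond _ _ _ _ W W1 W2 W4 s01 s02 s14 s24 i01 i02 (etrans ix (congr1 S i01)) n12.
have [e3 e4] := diamond _ _ _ _ W1 W3 W4 W5 s13 s14 s35 s45 i13 ix (etrans i35 (congr1 S i13)) n34.
split; first by rewrite -e4 -e2.
  by rewrite -e1.
by rewrite -e3.
Qed.
End Hexagons.

Definition put (s : bool) (x : nat) (l : seq nat) := if s then x :: l else l.

(** The equality of labels puts [y] inside [w], so [v] adds at most one element to [w]. Hence the
    union is small enough to be recognized as [X], and its new element is the one that [v] has
    beyond [y]. *)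
Lemma cup_transfer (P : finType) (o z w y v X : {set P}) :
    o \subset z -> z \subset w -> #|v :\: y| = 1 -> #|X :\: w| = 1 ->
    (#|v :|: w| <= #|w|.+1 -> X = v :|: w) -> w :\: z = y :\: o ->
  X :\: w = v :\: y.
Proof.
move=> oz zw cv cX XE E.
have yw : y \subset w.
  apply/subsetP => x xy; have [xo | xo] := boolP (x \in o).
    by rewrite (subsetP zw) // (subsetP oz).
  by have : x \in w :\: z; [rewrite E inE xo | rewrite inE => /andP[]].
have vy : v :\: w \subset v :\: y by apply: setDS.
have {}XE : X = v :|: w.
  apply: XE; have := subset_leq_card vy; have := subset_leq_card (subsetIl v w).
  by rewrite cv cardsU cardsD; clear; lia.
have XwE : X :\: w = v :\: w by rewrite XE setDUl setDv setU0.
by apply/eqP; rewrite XwE eqEcard vy cv -cX XwE leqnn.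
Qed.

(** * Relations between the labels of four letters *)

Section FourContext.

Variables (P : finType) (V : seq nat) (f : seq nat -> {set P}).
Hypotheses (uV : uniq V) (hf : middle_fun V f).
Variables (A D : seq nat) (a b c d : nat).
Hypotheses (ab : a < b) (bc : b < c) (cd : c < d).
Hypothesis W0 : perm_eq (A ++ [:: a, b, c, d & D]) V.

Let g s := f (A ++ s ++ D).
Let letters s := perm_eq s [:: a; b; c; d].

(* [s] and [t] tell whether the letters [p] and [q] are on the left.             *)
Definition side_label p q i j s t :=
  label f (put s p (put t q A)) i j (put (~~ s) p (put (~~ t) q D)).

Let word_letters s : letters s -> perm_eq (A ++ s ++ D) V.
Proof.
move=> ls; apply: perm_trans W0.
by rewrite perm_cat2l (perm_trans (_ : perm_eq _ ([:: a; b; c; d] ++ D))) ?perm_cat2r.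
Qed.

Let ac : a < c := ltn_trans ab bc.
Let bd : b < d := ltn_trans bc cd.
Let ad : a < d := ltn_trans ac cd.

Let card_g s : letters s -> #|g s| = #|g [:: a; b; c; d]| + inv s.
Proof.
move=> ls; have := middle_fun_card hf (word_letters ls) W0.
have := @inv_context A s [:: a; b; c; d] D ls.
rewrite [inv [:: a; _; _; _]]inv_sorted; last by rewrite /= ab bc cd.
rewrite /g /=; move: #|_| #|_| => x y; lia.
Qed.

Let edge_sub s1 i j s2 : letters (s1 ++ i :: j :: s2) -> i < j ->
  g (s1 ++ i :: j :: s2) \subset g (s1 ++ j :: i :: s2).
Proof.
move=> ls ij; have := @middle_fun_up _ _ _ hf (A ++ s1) i j (s2 ++ D).
rewrite /g -!catA /=; apply=> //.
by have := word_letters ls; rewrite -!catA.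
Qed.

Let edgeE p q i j s t s1 s2 :
    perm_eq (put s p (put t q [::])) s1 -> perm_eq (put (~~ s) p (put (~~ t) q [::])) s2 ->
    letters (s1 ++ i :: j :: s2) -> i < j ->
  side_label p q i j s t = g (s1 ++ j :: i :: s2) :\: g (s1 ++ i :: j :: s2).
Proof.
move=> p1 p2 ls ij; transitivity (label f (A ++ s1) i j (s2 ++ D)); last first.
  by rewrite /label /g -!catA.
apply/esym/(label_perm hf) => //.
- by have := word_letters ls; rewrite -!catA.
- apply: (@perm_trans _ (s1 ++ A)); last by rewrite perm_catC.
  rewrite -(perm_cat2r A) in p1; apply: perm_trans p1.
  by case: (s); case: (t).
rewrite -(perm_cat2r D) in p2; apply: perm_trans p2.
by case: (s); case: (t).
Qed.

(** A label gained at one step belongs to all later sets of the chain, so a later step cannot gain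
    it again. *)
Let label_neq s1 i j s2 t1 k l t2 :
    letters (s1 ++ i :: j :: s2) -> i < j ->
      g (s1 ++ j :: i :: s2) \subset g (t1 ++ k :: l :: t2) ->
  g (s1 ++ j :: i :: s2) :\: g (s1 ++ i :: j :: s2) <> g (t1 ++ l :: k :: t2) :\: g (t1 ++ k :: l :: t2).
Proof.
move=> ls ij sub E.
have : g (s1 ++ i :: j :: s2) \proper g (s1 ++ j :: i :: s2).
  rewrite properEcard edge_sub //=.
  have ls' : letters (s1 ++ j :: i :: s2).
    by apply: perm_trans ls; rewrite perm_cat2l (perm_catCA [:: j] [:: i]).
  by rewrite (card_g ls') (card_g ls) ltn_add2l (@inv_swap s1 i j).
case/properP=> _ [x xin xout].
have : x \in g (s1 ++ j :: i :: s2) :\: g (s1 ++ i :: j :: s2) by rewrite inE xout.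
by rewrite E inE (subsetP sub x xin).
Qed.

Ltac perm4 := apply/seq.permP => ? /=; clear; lia.

(** Here and in the next six lemmas, the two labels are realized on one chain; any inclusions left
    over are the intermediate steps of that chain. *)
Lemma label_neq1 : side_label a b c d true false <> side_label c d a b true true.
Proof.
have -> : side_label a b c d true false = g [:: a; d; c; b] :\: g [:: a; c; d; b]
  by apply: (@edgeE a b c d true false [:: a] [:: b]) => //; perm4.
have -> : side_label c d a b true true = g [:: d; c; b; a] :\: g [:: d; c; a; b]
  by apply: (@edgeE c d a b true true [:: d; c] [::]) => //; perm4.
apply: (@label_neq [:: a] c d [:: b] [:: d; c] a b [::]) => //; first by perm4.
refine (subset_trans (@edge_sub [::] a d [:: c; b] _ _) _) => //; first by perm4.
refine (subset_trans (@edge_sub [:: d] a c [:: b] _ _) _) => //; by perm4.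
Qed.

Lemma label_neq2 : side_label a b c d false true <> side_label a d b c false true.
Proof.
have -> : side_label a b c d false true = g [:: b; d; c; a] :\: g [:: b; c; d; a]
  by apply: (@edgeE a b c d false true [:: b] [:: a]) => //; perm4.
have -> : side_label a d b c false true = g [:: d; c; b; a] :\: g [:: d; b; c; a]
  by apply: (@edgeE a d b c false true [:: d] [:: a]) => //; perm4.
apply: (@label_neq [:: b] c d [:: a] [:: d] b c [:: a]) => //; first by perm4.
refine (subset_trans (@edge_sub [::] b d [:: c; a] _ _) _) => //; by perm4.
Qed.

Lemma label_neq3 : side_label a d b c true false <> side_label b c a d false false.
Proof.
have -> : side_label a d b c true false = g [:: a; c; b; d] :\: g [:: a; b; c; d]
  by apply: (@edgeE a d b c true false [:: a] [:: d]) => //; perm4.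
have -> : side_label b c a d false false = g [:: d; a; c; b] :\: g [:: a; d; c; b]
  by apply: (@edgeE b c a d false false [::] [:: c; b]) => //; perm4.
apply: (@label_neq [:: a] b c [:: d] [::] a d [:: c; b]) => //; first by perm4.
refine (subset_trans (@edge_sub [:: a; c] b d [::] _ _) _) => //; first by perm4.
refine (subset_trans (@edge_sub [:: a] c d [:: b] _ _) _) => //; by perm4.
Qed.

Lemma label_neq4 : side_label a d b c true false <> side_label b d a c false true.
Proof.
have -> : side_label a d b c true false = g [:: a; c; b; d] :\: g [:: a; b; c; d]
  by apply: (@edgeE a d b c true false [:: a] [:: d]) => //; perm4.
have -> : side_label b d a c false true = g [:: d; c; a; b] :\: g [:: d; a; c; b]
  by apply: (@edgeE b d a c false true [:: d] [:: b]) => //; perm4.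
apply: (@label_neq [:: a] b c [:: d] [:: d] a c [:: b]) => //; first by perm4.
refine (subset_trans (@edge_sub [:: a; c] b d [::] _ _) _) => //; first by perm4.
refine (subset_trans (@edge_sub [:: a] c d [:: b] _ _) _) => //; first by perm4.
refine (subset_trans (@edge_sub [::] a d [:: c; b] _ _) _) => //; by perm4.
Qed.

Lemma label_neq5 : side_label a d b c true false <> side_label b c a d true true.
Proof.
have -> : side_label a d b c true false = g [:: a; c; b; d] :\: g [:: a; b; c; d]
  by apply: (@edgeE a d b c true false [:: a] [:: d]) => //; perm4.
have -> : side_label b c a d true true = g [:: c; b; d; a] :\: g [:: c; b; a; d]
  by apply: (@edgeE b c a d true true [:: c; b] [::]) => //; perm4.
apply: (@label_neq [:: a] b c [:: d] [:: c; b] a d [::]) => //; first by perm4.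
refine (subset_trans (@edge_sub [::] a c [:: b; d] _ _) _) => //; first by perm4.
refine (subset_trans (@edge_sub [:: c] a b [:: d] _ _) _) => //; by perm4.
Qed.

Lemma label_neq6 : side_label b c a d false false <> side_label b d a c false true.
Proof.
have -> : side_label b c a d false false = g [:: d; a; c; b] :\: g [:: a; d; c; b]
  by apply: (@edgeE b c a d false false [::] [:: c; b]) => //; perm4.
have -> : side_label b d a c false true = g [:: d; c; a; b] :\: g [:: d; a; c; b]
  by apply: (@edgeE b d a c false true [:: d] [:: b]) => //; perm4.
apply: (@label_neq [::] a d [:: c; b] [:: d] a c [:: b]) => //; by perm4.
Qed.

Lemma label_neq7 : side_label b c a d true true <> side_label a c b d false true.
Proof.
have -> : side_label b c a d true true = g [:: c; b; d; a] :\: g [:: c; b; a; d]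
  by apply: (@edgeE b c a d true true [:: c; b] [::]) => //; perm4.
have -> : side_label a c b d false true = g [:: c; d; b; a] :\: g [:: c; b; d; a]
  by apply: (@edgeE a c b d false true [:: c] [:: a]) => //; perm4.
apply: (@label_neq [:: c; b] a d [::] [:: c] b d [:: a]) => //; by perm4.
Qed.

Let inv_letters s t : letters s -> letters t ->
  inv (A ++ s ++ D) + inv t = inv (A ++ t ++ D) + inv s.
Proof.
by move=> ls lt; apply: inv_context; rewrite (perm_trans ls) // perm_sym.
Qed.

Let card_edge s1 i j s2 : letters (s1 ++ i :: j :: s2) -> i < j ->
  #|g (s1 ++ j :: i :: s2) :\: g (s1 ++ i :: j :: s2)| = 1.
Proof.
move=> ls ij; have := @card_label _ _ _ hf (A ++ s1) i j (s2 ++ D).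
rewrite /label /g -!catA /=; apply=> //.
by have := word_letters ls; rewrite -!catA.
Qed.

Let ltE := (ltnn, ab, bc, cd, ac, bd, ad,
  ltnNge b a, ltnNge c b, ltnNge d c, ltnNge c a, ltnNge d b, ltnNge d a,
  ltnW ab, ltnW bc, ltnW cd, ltnW ac, ltnW bd, ltnW ad).

(** The premise puts [a c b d] below [a d b c], so the join of [c a b d] and [a d b c] is one step
    up. These words differ by a 3-cycle, and only the candidate [d a b c] has the right number of
    inversions. *)
Lemma join_forces1 : forces (side_label a c b d true false) (side_label a d b c true false)
  (side_label b d a c false false) (side_label b c a d false false).
Proof.
have e1 : side_label a c b d true false = g [:: a; d; b; c] :\: g [:: a; b; d; c]
  by apply: (@edgeE a c b d true false [:: a] [:: c]) => //; try perm4.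
have e2 : side_label a d b c true false = g [:: a; c; b; d] :\: g [:: a; b; c; d]
  by apply: (@edgeE a d b c true false [:: a] [:: d]) => //; try perm4.
have e3 : side_label b d a c false false = g [:: c; a; b; d] :\: g [:: a; c; b; d]
  by apply: (@edgeE b d a c false false [::] [:: b; d]) => //; try perm4.
have e4 : side_label b c a d false false = g [:: d; a; b; c] :\: g [:: a; d; b; c]
  by apply: (@edgeE b c a d false false [::] [:: b; c]) => //; try perm4.
rewrite /forces {}e1 {}e2 {}e3 {}e4 => E; apply/esym; move: E; apply: cup_transfer.
- by apply: (@edge_sub [:: a; b] c d [::]) => //; try perm4.
- by apply: (@edge_sub [:: a] b d [:: c]) => //; try perm4.
- by apply: (@card_edge [::] a c [:: b; d]) => //; try perm4.
- by apply: (@card_edge [::] a d [:: b; c]) => //; try perm4.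
have lv : letters [:: c; a; b; d] by perm4.
have lw : letters [:: a; d; b; c] by perm4.
have ivw : inv [:: c; a; b; d] = inv [:: a; d; b; c] by rewrite /= !ltE.
have cvw : #|g [:: c; a; b; d]| = #|g [:: a; d; b; c]| by rewrite (card_g lv) (card_g lw) ivw.
rewrite -cvw => le.
have {}ivw : inv (A ++ [:: c; a; b; d] ++ D) = inv (A ++ [:: a; d; b; c] ++ D)
  by have := inv_letters lv lw; rewrite ivw => /addIn.
have nab : c <> a by apply/eqP; rewrite neq_ltn !ltE ?orbT.
have [x [_ fx ix cases]] := @cycle_cup _ _ _ uV hf A [::] [:: b] D c a d (word_letters lv) nab ivw le.
case: cases => Ex; rewrite {}Ex in fx ix; rewrite /g.
- by have := @inv_letters [:: a; c; b; d] [:: c; a; b; d] _ lv;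
  rewrite [inv (_ ++ _)]ix /= !ltE => H; exfalso; move: (H ltac:(perm4)); clear; lia.
- by have := @inv_letters [:: c; d; b; a] [:: c; a; b; d] _ lv;
  rewrite [inv (_ ++ _)]ix /= !ltE => H; exfalso; move: (H ltac:(perm4)); clear; lia.
- by rewrite fx.
Qed.

(** The same argument for [b c a d] and [a c d b], whose join is forced to be [b c d a]. *)
Lemma join_forces3 : forces (side_label b d a c true false) (side_label a d b c true false)
  (side_label a c b d true true) (side_label b c a d true true).
Proof.
have e1 : side_label b d a c true false = g [:: b; c; a; d] :\: g [:: b; a; c; d]
  by apply: (@edgeE b d a c true false [:: b] [:: d]) => //; try perm4.
have e2 : side_label a d b c true false = g [:: a; c; b; d] :\: g [:: a; b; c; d]
  by apply: (@edgeE a d b c true false [:: a] [:: d]) => //; try perm4.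
have e3 : side_label a c b d true true = g [:: a; c; d; b] :\: g [:: a; c; b; d]
  by apply: (@edgeE a c b d true true [:: a; c] [::]) => //; try perm4.
have e4 : side_label b c a d true true = g [:: b; c; d; a] :\: g [:: b; c; a; d]
  by apply: (@edgeE b c a d true true [:: b; c] [::]) => //; try perm4.
rewrite /forces {}e1 {}e2 {}e3 {}e4 => E; apply/esym; move: E; apply: cup_transfer.
- by apply: (@edge_sub [::] a b [:: c; d]) => //; try perm4.
- by apply: (@edge_sub [:: b] a c [:: d]) => //; try perm4.
- by apply: (@card_edge [:: a; c] b d [::]) => //; try perm4.
- by apply: (@card_edge [:: b; c] a d [::]) => //; try perm4.
have lv : letters [:: b; c; a; d] by perm4.
have lw : letters [:: a; c; d; b] by perm4.
have ivw : inv [:: b; c; a; d] = inv [:: a; c; d; b] by rewrite /= !ltE.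
have cvw : #|g [:: b; c; a; d]| = #|g [:: a; c; d; b]| by rewrite (card_g lv) (card_g lw) ivw.
rewrite setUC => le.
have {}ivw : inv (A ++ [:: b; c; a; d] ++ D) = inv (A ++ [:: a; c; d; b] ++ D)
  by have := inv_letters lv lw; rewrite ivw => /addIn.
have nab : b <> a by apply/eqP; rewrite neq_ltn !ltE ?orbT.
have [x [_ fx ix cases]] := @cycle_cup _ _ _ uV hf A [:: c] [::] D b a d (word_letters lv) nab ivw le.
case: cases => Ex; rewrite {}Ex in fx ix; rewrite /g.
- by have := @inv_letters [:: a; c; b; d] [:: b; c; a; d] _ lv;
  rewrite [inv (_ ++ _)]ix /= !ltE => H; exfalso; move: (H ltac:(perm4)); clear; lia.
- by rewrite fx setUC.
- by have := @inv_letters [:: d; c; a; b] [:: b; c; a; d] _ lv;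
  rewrite [inv (_ ++ _)]ix /= !ltE => H; exfalso; move: (H ltac:(perm4)); clear; lia.
Qed.

(** The common label is missing from both [c b d a] and [d a c b], hence from their union, which is
    thus not all of [d c b a] and lies one step up. These words differ by a double transposition,
    and the join must be [d b c a]; the last step to [d c b a] gains the missing label. *)
Lemma join_forces6 : forces (side_label a c b d false true) (side_label b d a c false true)
  (side_label a d b c false true) (side_label a c b d false true).
Proof.
have e1 : side_label a c b d false true = g [:: c; d; b; a] :\: g [:: c; b; d; a]
  by apply: (@edgeE a c b d false true [:: c] [:: a]) => //; try perm4.
have e2 : side_label b d a c false true = g [:: d; c; a; b] :\: g [:: d; a; c; b]
  by apply: (@edgeE b d a c false true [:: d] [:: b]) => //; try perm4.
have e3 : side_label a d b c false true = g [:: d; c; b; a] :\: g [:: d; b; c; a]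
  by apply: (@edgeE a d b c false true [:: d] [:: a]) => //; try perm4.
rewrite /forces {}e1 {}e2 {}e3 => E.
have lv : letters [:: c; b; d; a] by perm4.
have lw : letters [:: d; a; c; b] by perm4.
have lx : letters [:: d; b; c; a] by perm4.
have lF : letters [:: d; c; b; a] by perm4.
have c1 : #|g [:: c; d; b; a] :\: g [:: c; b; d; a]| = 1.
  by apply: (@card_edge [:: c] b d [:: a]) => //; try perm4.
have c3 : #|g [:: d; c; b; a] :\: g [:: d; b; c; a]| = 1.
  by apply: (@card_edge [:: d] b c [:: a]) => //; try perm4.
have vF : g [:: c; b; d; a] \subset g [:: d; c; b; a].
  refine (subset_trans (@edge_sub [:: c] b d [:: a] _ _) _) => //; try by perm4.
  by apply: (@edge_sub [::] c d [:: b; a]) => //; try perm4.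
have wF : g [:: d; a; c; b] \subset g [:: d; c; b; a].
  refine (subset_trans (@edge_sub [:: d] a c [:: b] _ _) _) => //; try by perm4.
  by apply: (@edge_sub [:: d; c] a b [::]) => //; try perm4.
have labF : g [:: c; d; b; a] :\: g [:: c; b; d; a] \subset g [:: d; c; b; a].
  apply: subset_trans (subsetDl _ _) _.
  by apply: (@edge_sub [::] c d [:: b; a]) => //; try perm4.
have vwF : g [:: c; b; d; a] :|: g [:: d; a; c; b] \subset
    g [:: d; c; b; a] :\: (g [:: c; d; b; a] :\: g [:: c; b; d; a]).
  apply/subsetP => x xvw; rewrite in_setD; apply/andP; split; last first.
    by case/setUP: xvw => [/(subsetP vF) | /(subsetP wF)].
  apply/negP => xm; case/setUP: xvw => xin; last rewrite E in xm.
    by move: xm; rewrite in_setD xin.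
  by move: xm; rewrite in_setD xin.
have ivw : inv [:: c; b; d; a] = inv [:: d; a; c; b] by rewrite /= !ltE.
have {}ivw : inv (A ++ [:: c; b; d; a] ++ D) = inv (A ++ [:: d; a; c; b] ++ D).
  by have := inv_letters lv lw; rewrite ivw => /addIn.
have le : #|g [:: c; b; d; a] :|: g [:: d; a; c; b]| <= #|g [:: c; b; d; a]|.+1.
  apply: leq_trans (subset_leq_card vwF) _.
  rewrite cardsD (setIidPr labF) c1 (card_g lF) (card_g lv) /= !ltE.
  by move: #|_| => k; clear; lia.
have nvw : A ++ [:: c; b; d; a] ++ D <> A ++ [:: d; a; c; b] ++ D.
  by move/eqP; rewrite eqseq_cat // eqxx /= eqseq_cons (ltn_eqF cd).
have [x [_ fx ix vx wx]] := cup_cover hf (word_letters lv) (word_letters lw) nvw ivw le.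
have := swapped_double _ (word_letters lv) vx wx.
rewrite (perm_uniq (word_letters lv)) => /(_ uV)[] Ex; rewrite {}Ex in fx ix; last first.
  have l0 : letters [:: c; a; d; b] by perm4.
  by have := inv_letters l0 lv; rewrite [inv (_ ++ _)]ix /= !ltE; clear; lia.
apply/esym/eqP; rewrite eqEcard c3 c1 leqnn andbT; apply/subsetP => e em.
rewrite in_setD (subsetP labF) // andbT [g _]fx; apply/negP => /(subsetP vwF).
by rewrite in_setD em.
Qed.

End FourContext.

(** * Reversal of words *)

Section Duality.

Variables (P : finType) (V : seq nat) (f : seq nat -> {set P}).
Hypotheses (uV : uniq V) (hf : middle_fun V f).

(* Reversing words and complementing sets exchanges joins and meets, so that it  *)
(* halves the number of four-letter facts to establish.                          *)
Definition dual_fun (w : seq nat) : {set P} := ~: f (rev w).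

Lemma exchange_mapK p q (v x : seq nat) : x = map (exchange p q) v -> v = map (exchange p q) x.
Proof. by move->; rewrite (mapK (exchangeK p q)). Qed.

Lemma middle_fun_dual : middle_fun V dual_fun.
Proof.
have revV v : perm_eq v V -> perm_eq (rev v) V by rewrite perm_rev.
have inv_revE v : perm_eq v V -> inv v + inv (rev v) = 'C(size V, 2).
  by move=> vV; rewrite inv_rev ?(perm_size vV) // (perm_uniq vV).
split.
- move=> v w vV wV; have := middle_fun_card hf (revV v vV) (revV w wV).
  have := inv_revE v vV; have := inv_revE w wV.
  rewrite /dual_fun; have := cardsC (f (rev v)); have := cardsC (f (rev w)).
  by move: #|f _| #|f _| #|~: _| #|~: _| #|P| => k1 k2 k3 k4 k5; clear; lia.
- move=> A i j B W ij; rewrite /dual_fun setCS !rev_cat !rev_cons -!cats1 -!catA /=.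
  apply: (middle_fun_up hf) => //; apply: perm_trans (revV _ W).
  by rewrite rev_cat !rev_cons -!cats1 -!catA /= perm_cat2l (perm_catCA [:: i] [:: j]).
- move=> v w vV wV /setC_inj/(middle_fun_inj hf (revV v vV) (revV w wV)).
  by apply: inv_inj; apply: revK.
- move=> v w vV wV; have [x xV fx] := middle_fun_cap hf (revV v vV) (revV w wV).
  by exists (rev x); rewrite ?revV // /dual_fun revK fx setCI.
- move=> v w vV wV; have [x xV fx] := middle_fun_cup hf (revV v vV) (revV w wV).
  by exists (rev x); rewrite ?revV // /dual_fun revK fx setCU.
move=> v x vV xV; rewrite /dual_fun setCS => sub ix.
have [|p [q [pV qV E]]] := middle_fun_cover hf (revV x xV) (revV v vV) sub.
  by have := inv_revE v vV; have := inv_revE x xV; rewrite ix; clear; lia.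
exists p, q; split=> //; apply: (inv_inj revK); rewrite -map_rev.
exact: exchange_mapK.
Qed.

Lemma label_dual A i j B : label dual_fun A i j B = label f (rev B) i j (rev A).
Proof.
rewrite /label /dual_fun !rev_cat !rev_cons -!cats1 -!catA /=.
by apply/setP => x; rewrite !inE negbK andbC.
Qed.

Variables (A D : seq nat) (a b c d : nat).
Hypothesis W0 : perm_eq (A ++ [:: a, b, c, d & D]) V.

Lemma side_label_eq p q i j s t X Y : i < j -> perm_eq [:: p; q; i; j] [:: a; b; c; d] ->
    perm_eq X (put s p (put t q A)) -> perm_eq Y (put (~~ s) p (put (~~ t) q D)) ->
  side_label f A D p q i j s t = label f X i j Y.
Proof.
move=> ij ls pX pY; apply: (label_perm hf) => //.
apply: perm_trans W0.
apply: (@perm_trans _ ([:: p; q; i; j] ++ (A ++ D))).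
  by case: (s) (t) => [] [] /=; apply/seq.permP => ?;
    rewrite /= !count_cat /= ?count_cat; clear; lia.
rewrite -(perm_cat2r (A ++ D)) in ls; apply: perm_trans ls _.
by rewrite perm_catCA.
Qed.

Lemma side_label_dual p q i j s t : i < j -> perm_eq [:: p; q; i; j] [:: a; b; c; d] ->
  side_label dual_fun (rev D) (rev A) p q i j s t = side_label f A D p q i j (~~ s) (~~ t).
Proof.
move=> ij ls; rewrite [LHS]label_dual; apply/esym/side_label_eq => //.
  by rewrite perm_rev; case: (s) (t) => [] [] /=; rewrite ?perm_cons perm_rev.
by rewrite perm_rev; case: (s) (t) => [] [] /=; rewrite ?perm_cons perm_rev.
Qed.
End Duality.

(** * The types of the four triples of four letters *)

Section FourContextTypes.

Variables (P : finType) (V : seq nat) (f : seq nat -> {set P}).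
Hypotheses (uV : uniq V) (hf : middle_fun V f).
Variables (A D : seq nat) (a b c d : nat).
Hypotheses (ab : a < b) (bc : b < c) (cd : c < d).
Hypothesis W0 : perm_eq (A ++ [:: a, b, c, d & D]) V.

Let W0' : perm_eq (rev D ++ [:: a, b, c, d & rev A]) V.
Proof.
apply: perm_trans W0; rewrite (@perm_trans _ (D ++ [:: a; b; c; d] ++ A)) //.
  by apply: perm_cat; [rewrite perm_rev | rewrite !perm_cons perm_rev].
by rewrite perm_catC -catA perm_catCA catA.
Qed.

Let side := side_label f A D.
Let hf' := middle_fun_dual uV hf.
Let ac : a < c := ltn_trans ab bc.
Let bd : b < d := ltn_trans bc cd.
Let ad : a < d := ltn_trans ac cd.

Let dualE p q i j s t : i < j -> perm_eq [:: p; q; i; j] [:: a; b; c; d] ->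
  side_label (dual_fun f) (rev D) (rev A) p q i j s t = side p q i j (~~ s) (~~ t) := 
  @side_label_dual P V f hf A D a b c d W0 p q i j s t.

Ltac perm4 := apply/seq.permP => ? /=; clear; lia.

Let E2 : forces (side a d b c false true) (side a c b d false true) (side b d a c true true) (side b c a d true true).
Proof.
have := join_forces1 uV hf' ab bc cd W0'.
rewrite !dualE //; try perm4.
by rewrite /forces => H /esym.
Qed.

Let E4 : forces (side b d a c false true) (side a d b c false true) (side a c b d false false) (side b c a d false false).
Proof.
have := join_forces3 uV hf' ab bc cd W0'.
rewrite !dualE //; try perm4.
Qed.

Let E5 : forces (side b d a c true false) (side a c b d true false) (side a d b c true false) (side a c b d true false).
Proof.
have := join_forces6 uV hf' ab bc cd W0'.
rewrite !dualE //; try perm4.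
by rewrite /forces => H /esym.
Qed.

Definition type123 s := hexagon_type f (put s d A) a b c (put (~~ s) d D).
Definition type124 s := hexagon_type f (put s c A) a b d (put (~~ s) c D).
Definition type134 s := hexagon_type f (put s b A) a c d (put (~~ s) b D).
Definition type234 s := hexagon_type f (put s a A) b c d (put (~~ s) a D).

Ltac solve_side conv e1 e2 e3 :=
  first [apply: (conv _ _ _ _ _ _ _ _ _ _ _ _ _ _ _ _ e1) => //; perm4
    | apply: (conv _ _ _ _ _ _ _ _ _ _ _ _ _ _ _ _ e2) => //; perm4
    | apply: (conv _ _ _ _ _ _ _ _ _ _ _ _ _ _ _ _ e3) => //; perm4].

Let word_triple x i j k s : perm_eq [:: x; i; j; k] [:: a; b; c; d] ->
  perm_eq (put s x A ++ [:: i, j, k & put (~~ s) x D]) V.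
Proof.
move=> ls; apply: perm_trans W0; apply: (@perm_trans _ ([:: x; i; j; k] ++ (A ++ D))).
  by case: (s); apply/seq.permP => ?; rewrite /= ?count_cat /= ?count_cat; clear; lia.
rewrite -(perm_cat2r (A ++ D)) in ls; apply: perm_trans ls _.
by rewrite perm_catCA.
Qed.

Let sideE := side_label_eq hf W0.

Lemma four_context :
  [/\ forall s, type123 s = type123 false, forall s, type124 s = type124 false,
      forall s, type134 s = type134 false & forall s, type234 s = type234 false] /\
  (type123 false, type124 false, type134 false, type234 false) \in
    [:: (false, false, false, false); (false, false, true, true);
        (true, false, false, false); (true, true, true, false);
        (true, true, true, true)].
Proof.
have conv p q i j s t p' q' i' j' s' t' X Y X' Y' :
    label f X i j Y = label f X' i' j' Y' -> i < j -> i' < j' ->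
    perm_eq [:: p; q; i; j] [:: a; b; c; d] -> perm_eq [:: p'; q'; i'; j'] [:: a; b; c; d] ->
    perm_eq X (put s p (put t q A)) -> perm_eq Y (put (~~ s) p (put (~~ t) q D)) ->
    perm_eq X' (put s' p' (put t' q' A)) -> perm_eq Y' (put (~~ s') p' (put (~~ t') q' D)) ->
  side p q i j s t = side p' q' i' j' s' t'.
  by move=> e ij ij' l1 l2 pX pY pX' pY';
    rewrite /side (sideE ij l1 pX pY) e -(sideE ij' l2 pX' pY').
apply: (@four_letters _ (side c d a b) (side b d a c) (side b c a d)
  (side a d b c) (side a c b d) (side a b c d)).
- move=> s; have := @hexagonP _ _ _ uV hf (put s d A) a b c (put (~~ s) d D) (word_triple _ _) ab bc.
  by rewrite -/(type123 s) => /(_ ltac:(perm4)); case: (type123 s); case: s =>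
    -[e1 e2 e3]; split; solve_side conv e1 e2 e3.
- move=> s; have := @hexagonP _ _ _ uV hf (put s c A) a b d (put (~~ s) c D) (word_triple _ _) ab bd.
  by rewrite -/(type124 s) => /(_ ltac:(perm4)); case: (type124 s); case: s =>
    -[e1 e2 e3]; split; solve_side conv e1 e2 e3.
- move=> s; have := @hexagonP _ _ _ uV hf (put s b A) a c d (put (~~ s) b D) (word_triple _ _) ac cd.
  by rewrite -/(type134 s) => /(_ ltac:(perm4)); case: (type134 s); case: s =>
    -[e1 e2 e3]; split; solve_side conv e1 e2 e3.
- move=> s; have := @hexagonP _ _ _ uV hf (put s a A) b c d (put (~~ s) a D) (word_triple _ _) bc cd.
  by rewrite -/(type234 s) => /(_ ltac:(perm4)); case: (type234 s); case: s =>
    -[e1 e2 e3]; split; solve_side conv e1 e2 e3.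
- exact: (label_neq1 uV hf ab bc cd W0).
- exact: (label_neq2 uV hf ab bc cd W0).
- exact: (label_neq3 uV hf ab bc cd W0).
- exact: (label_neq4 uV hf ab bc cd W0).
- exact: (label_neq5 uV hf ab bc cd W0).
- exact: (label_neq6 uV hf ab bc cd W0).
- exact: (label_neq7 uV hf ab bc cd W0).
- exact: (join_forces1 uV hf ab bc cd W0).
- exact: E2.
- exact: (join_forces3 uV hf ab bc cd W0).
- exact: E4.
- exact: E5.
exact: (join_forces6 uV hf ab bc cd W0).
Qed.
End FourContextTypes.

(** * Splitting the letters *)

Record typed_fun (P : finType) (V : seq nat) (f : seq nat -> {set P})
    (ty : nat -> nat -> nat -> bool) : Prop := TypedFun {
  typed_fun_step : forall A i j B, perm_eq (A ++ i :: j :: B) V -> i < j ->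
    f (A ++ i :: j :: B) \subset f (A ++ j :: i :: B) /\ #|label f A i j B| = 1;
  typed_fun_perm : forall A A' i j B B', perm_eq (A ++ i :: j :: B) V -> i < j ->
    perm_eq A' A -> perm_eq B' B -> label f A i j B = label f A' i j B';
  typed_fun_hexagon : forall A i j k B, perm_eq (A ++ i :: j :: k :: B) V ->
    i < j -> j < k -> hexagon f (ty i j k) A i j k B;
  typed_fun_types : forall a b c d, {subset [:: a; b; c; d] <= V} ->
    a < b -> b < c -> c < d ->
    (ty a b c, ty a b d, ty a c d, ty b c d) \in
    [:: (false, false, false, false); (false, false, true, true);
        (true, false, false, false); (true, true, true, false);
        (true, true, true, true)] }.

Section TypedOfMiddle.

Variables (P : finType) (V : seq nat) (f : seq nat -> {set P}).
Hypotheses (uV : uniq V) (hf : middle_fun V f).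

Lemma hexagon_type_perm A A' i j k B B' : perm_eq (A ++ i :: j :: k :: B) V -> i < j -> j < k ->
  perm_eq A' A -> perm_eq B' B -> hexagon_type f A i j k B = hexagon_type f A' i j k B'.
Proof.
move=> W ij jk AA BB; have ik := ltn_trans ij jk.
rewrite /hexagon_type.
rewrite (@label_perm _ _ _ hf A A' i j (k :: B) (k :: B')) ?perm_cons //.
rewrite (@label_perm _ _ _ hf (k :: A) (k :: A') i j B B') ?perm_cons //; last by solve_perm W.
rewrite (@label_perm _ _ _ hf (j :: A) (j :: A') i k B B') ?perm_cons //; last by solve_perm W.
rewrite (@label_perm _ _ _ hf (i :: A) (i :: A') j k B B') ?perm_cons //; last by solve_perm W.
rewrite (@label_perm _ _ _ hf A A' i k (j :: B) (j :: B')) ?perm_cons //; last by solve_perm W.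
rewrite (@label_perm _ _ _ hf A A' j k (i :: B) (i :: B')) ?perm_cons //; last by solve_perm W.
Qed.

(** Whatever the rank of [l] among the four letters, [four_context] says that the type does not see
    its side. *)
Lemma hexagon_type_move l A i j k B : perm_eq (A ++ i :: j :: k :: l :: B) V -> i < j -> j < k ->
  hexagon_type f (l :: A) i j k B = hexagon_type f A i j k (l :: B).
Proof.
move=> W ij jk.
have nl : l \notin [:: i; j; k].
  have := uV; rewrite -(perm_uniq W) cat_uniq => /and3P[_ _].
  rewrite /= !inE !negb_or ![_ == l]eq_sym.
  by case/and4P=> /and4P[_ _ -> _] /and3P[_ -> _] /andP[-> _] _.
move: nl; rewrite !inE !negb_or => /and3P[nli nlj nlk].
have [li | il | E] := ltngtP l i; last by rewrite E eqxx in nli.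
  have W' : perm_eq (A ++ [:: l, i, j, k & B]) V by solve_perm W.
  by have [[_ _ _ H] _] := four_context uV hf li ij jk W'; apply: (H true).
have [lj | jl | E] := ltngtP l j; last by rewrite E eqxx in nlj.
  have W' : perm_eq (A ++ [:: i, l, j, k & B]) V by solve_perm W.
  by have [[_ _ H _] _] := four_context uV hf il lj jk W'; apply: (H true).
have [lk | kl | E] := ltngtP l k; last by rewrite E eqxx in nlk.
  have W' : perm_eq (A ++ [:: i, j, l, k & B]) V by solve_perm W.
  by have [[_ H _ _] _] := four_context uV hf ij jl lk W'; apply: (H true).
by have [[H _ _ _] _] := four_context uV hf ij jk kl W; apply: (H true).
Qed.

Definition triple_type i j k := 
  hexagon_type f [::] i j k [seq x <- V | x \notin [:: i; j; k]].

Lemma triple_typeE A i j k B : perm_eq (A ++ i :: j :: k :: B) V -> i < j -> j < k ->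
  hexagon_type f A i j k B = triple_type i j k.
Proof.
move=> W ij jk; transitivity (hexagon_type f [::] i j k (A ++ B)).
  elim: A B W => // l A IHA B W; rewrite hexagon_type_move //; last by solve_perm W.
  rewrite IHA; last by solve_perm W.
  apply: hexagon_type_perm => //; first by solve_perm W.
  by rewrite perm_sym (perm_catCA A [:: l]).
have W' : perm_eq (i :: j :: k :: (A ++ B)) V by solve_perm W.
apply: hexagon_type_perm => //.
have := uV; rewrite -(perm_uniq W') -[i :: _]/([:: i; j; k] ++ (A ++ B)) cat_uniq.
case/and3P=> _ /hasPn dis _.
have -> : A ++ B = [seq x <- [:: i; j; k] ++ (A ++ B) | x \notin [:: i; j; k]].
  rewrite filter_cat (_ : filter _ [:: i; j; k] = [::]); last by rewrite /= !inE !eqxx !orbT.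
  by apply/esym/all_filterP/allP => x /dis.
by apply: perm_filter; rewrite perm_sym.
Qed.

Lemma typed_of_middle : typed_fun V f triple_type.
Proof.
split.
- move=> A i j B W ij; have [_ sub _] := middle_fun_step hf W ij.
  by rewrite (card_label hf W ij).
- exact: (label_perm hf).
- by move=> A i j k B W ij jk; rewrite -(triple_typeE W) //; exact: (hexagonP uV hf W ij jk).
move=> a b c d sub ab bc cd.
have bd := ltn_trans bc cd; have ac := ltn_trans ab bc; have ad := ltn_trans ab bd.
have [D W] : exists D, perm_eq ([::] ++ [:: a, b, c, d & D]) V.
  exists [seq x <- V | x \notin [:: a; b; c; d]].
  apply: (@perm_trans _ ([seq x <- V | x \in [:: a; b; c; d]] ++ [seq x <- V | x \notin [:: a; b;
    c; d]])).
    rewrite -[[::] ++ _]/([:: a; b; c; d] ++ _) perm_cat2r; apply: uniq_perm.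
    - by rewrite /= !inE !negb_or !neq_ltn ab bc cd ac bd ad.
    - exact: filter_uniq.
    by move=> x; rewrite mem_filter; case xin: (x \in _) => //=; rewrite sub.
  by rewrite perm_filterC.
have [_] := four_context uV hf ab bc cd W.
rewrite /type123 /type124 /type134 /type234 /= !triple_typeE //; solve_perm W.
Qed.
End TypedOfMiddle.

(** Keep the marked position fixed and rearrange the word by adjacent swaps: each swap either avoids
    this position or trades the marked letter with a neighbour. *)
Lemma marked_perm (U : Type) (h : seq nat -> nat -> seq nat -> U) (s0 : seq nat) :
    (forall A A' i B B', perm_eq (A ++ i :: B) s0 -> perm_eq A' A -> perm_eq B' B ->
      h A i B = h A' i B') ->
    (forall A a i B, perm_eq (A ++ a :: i :: B) s0 -> h (a :: A) i B = h (i :: A) a B) ->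
    (forall A i b B, perm_eq (A ++ i :: b :: B) s0 -> h A i (b :: B) = h A b (i :: B)) ->
  forall A i B A' i' B', perm_eq (A ++ i :: B) s0 -> perm_eq (A' ++ i' :: B') s0 ->
    size A = size A' -> h A i B = h A' i' B'.
Proof.
move=> hperm hleft hright A i B A' i' B' W W' szA.
pose mark x s := h (take x s) (nth 0 s x) (drop x.+1 s).
have markE C j D : mark (size C) (C ++ j :: D) = h C j D.
  by rewrite /mark take_size_cat // nth_cat ltnn subnn /= drop_cat ltnNge leqnSn subSnn /= drop0.
rewrite -markE -[RHS]markE szA.
have split_at (C : seq nat) x : x < size C -> C = take x C ++ nth 0 C x :: drop x.+1 C.
  by move=> xC; rewrite -drop_nth // cat_take_drop.
have lt_x : size A' < size s0 by rewrite -(perm_size W') size_cat /= addnS ltnS leq_addr.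
move: (size A') lt_x => x lt_x.
apply: (eq_perm_adjacent (s0 := s0)) => // C a b D W1.
have W2 : perm_eq (C ++ b :: a :: D) s0.
  by apply: perm_trans W1; rewrite perm_cat2l (perm_catCA [:: b] [:: a]).
have [xC | Cx | ->] := ltngtP x (size C); last by rewrite !markE hright.
  move: W1 W2; rewrite (split_at C x xC) -!catA /= => W1 W2.
  have sz : size (take x C) = x by rewrite size_take xC.
  rewrite -[in mark x]sz !markE; apply: hperm W1 _ _ => //.
  by rewrite perm_cat2l (perm_catCA [:: b] [:: a]).
have [x1 | x1 | x1] := ltngtP x (size C).+1; first by move: x1; rewrite ltnS leqNgt Cx.
  have xD : x - (size C).+2 < size D.
    by move: lt_x; rewrite -(perm_size W1) size_cat /=; move: x1; clear; lia.
  move: W1 W2; rewrite (split_at D _ xD).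
  move: (take _ D) (size_takel (ltnW xD)) (nth _ _ _) (drop _ D) => D1 sz d D2 W1 W2.
  have E s t : C ++ s :: t :: D1 ++ d :: D2 = (C ++ s :: t :: D1) ++ d :: D2 by rewrite -catA.
  have szE s t : x = size (C ++ s :: t :: D1).
    by rewrite size_cat /= sz; move: x1; clear; lia.
  rewrite !E in W1 W2 *; rewrite [in LHS](szE a b) [in RHS](szE b a) !markE.
  by apply: hperm W1 _ _ => //; rewrite perm_cat2l (perm_catCA [:: b] [:: a]).
have E s t : C ++ s :: t :: D = (C ++ [:: s]) ++ t :: D by rewrite -catA.
have szE s : x = size (C ++ [:: s]) by rewrite x1 size_cat addn1.
have W1' := W1; have W2' := W2.
rewrite !E in W1 W2 *; rewrite [in LHS](szE a) [in RHS](szE b) !markE.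
rewrite (hperm _ (a :: C) _ _ D W1) //; last by rewrite perm_sym perm_catC.
by rewrite (hperm _ (b :: C) _ _ D W2) //; [apply: hleft | rewrite perm_sym perm_catC].
Qed.

Lemma card_bigcup_le (P I : finType) (Q : pred I) (F : I -> {set P}) :
  #|\bigcup_(i | Q i) F i| <= \sum_(i | Q i) #|F i|.
Proof.
elim/big_rec2: _ => [|i k U _ le]; first by rewrite cards0.
by apply: leq_trans (leq_add (leqnn _) le); rewrite cardsU leq_subr.
Qed.

Lemma eq_of_card_bigcup (P I : finType) (F : I -> {set P}) :
  \sum_i #|F i| <= #|\bigcup_i F i| -> forall i j z, z \in F i -> z \in F j -> i = j.
Proof.
move=> le i j z zi zj; apply/eqP; apply: contraTT le => nij; rewrite -ltnNge.
rewrite (bigD1 i) //= [in ltnRHS](bigD1 i) //= cardsU.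
have le := card_bigcup_le (fun k => k != i) F.
have : 0 < #|F i :&: \bigcup_(k | k != i) F k|.
  apply/card_gt0P; exists z; rewrite inE zi /=.
  by apply/bigcupP; exists j; rewrite // eq_sym.
have := subset_leq_card (subsetIl (F i) (\bigcup_(k | k != i) F k)).
by move: le; clear; lia.
Qed.

Section TypedCard.

Variables (P : finType) (V : seq nat) (f : seq nat -> {set P}) (ty : nat -> nat -> nat -> bool).
Hypotheses (sV : sorted ltn V) (fV : f V = set0) (hf : typed_fun V f ty).

Lemma typed_fun_card w : perm_eq w V -> #|f w| = inv w.
Proof.
move: w; apply: word_ind => //; first by rewrite fV cards0 inv_sorted.
move=> A i j B W ij IH; have [/setIidPr sub lab] := typed_fun_step hf W ij.
by rewrite inv_swap // -IH -(cardsID (f (A ++ i :: j :: B))) sub lab addn1.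
Qed.

Lemma typed_fun_max w : perm_eq w V -> f w \subset f (rev V).
Proof.
rewrite -perm_rev -{2}[w]revK; move: (rev w); apply: word_ind => // A i j B W ij.
apply: subset_trans; rewrite !rev_cat !rev_cons -!cats1 -!catA /=.
have [] // := @typed_fun_step _ _ _ _ hf (rev B) i j (rev A).
apply: perm_trans W; apply/seq.permP => k.
by rewrite !count_cat /= !count_rev; clear; lia.
Qed.

End TypedCard.

Lemma typed_fun_suffix (P : finType) (V U W : seq nat) (f : seq nat -> {set P}) ty :
  typed_fun V f ty -> perm_eq (U ++ W) V -> typed_fun U (fun u => f (u ++ W)) ty.
Proof.
move=> hf UW; pose g u := f (u ++ W).
have word u : perm_eq u U -> perm_eq (u ++ W) V.
  by move=> uU; apply: perm_trans UW; rewrite perm_cat2r.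
have labE A i j B : label g A i j B = label f A i j (B ++ W) by rewrite /label /g -!catA.
split.
- move=> A i j B /word; rewrite labE -!catA; exact: (typed_fun_step hf).
- move=> A A' i j B B' /word; rewrite !labE -!catA => W1 ij AA BB.
  by apply: (typed_fun_perm hf) => //; rewrite perm_cat2r.
- move=> A i j k B /word; rewrite -catA => W1 ij jk.
  have := typed_fun_hexagon hf W1 ij jk.
  by rewrite /hexagon; case: (ty i j k) => -[e1 e2 e3]; split; rewrite !labE.
move=> a b c d sub; apply: (typed_fun_types hf) => x /sub xU.
by rewrite -(perm_mem UW) mem_cat xU.
Qed.

Lemma typed_fun_prefix (P : finType) (V U W : seq nat) (f : seq nat -> {set P}) ty :
  typed_fun V f ty -> perm_eq (W ++ U) V -> typed_fun U (fun u => f (W ++ u)) ty.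
Proof.
move=> hf WU; pose g u := f (W ++ u).
have word u : perm_eq u U -> perm_eq (W ++ u) V.
  by move=> uU; apply: perm_trans WU; rewrite perm_cat2l.
have labE A i j B : label g A i j B = label f (W ++ A) i j B by rewrite /label /g -!catA.
have front x A i j B : perm_eq (A ++ x :: i :: j :: B) U -> i < j ->
    label g (x :: A) i j B = label f (x :: (W ++ A)) i j B.
  move=> /word W1 ij; rewrite labE; apply: (typed_fun_perm hf) => //; first by solve_perm W1.
  by rewrite -[x :: A]cat1s perm_sym perm_catCA.
split.
- move=> A i j B /word; rewrite labE /g !catA; exact: (typed_fun_step hf).
- move=> A A' i j B B' /word; rewrite !labE !catA => W1 ij AA BB.
  by apply: (typed_fun_perm hf) => //; rewrite perm_cat2l.
- move=> A i j k B W1 ij jk; have ik := ltn_trans ij jk.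
  have W2 := word _ W1; rewrite catA in W2; have := typed_fun_hexagon hf W2 ij jk.
  have f1 : label g (k :: A) i j B = label f (k :: (W ++ A)) i j B
    by apply: front => //; solve_perm W1.
  have f2 : label g (j :: A) i k B = label f (j :: (W ++ A)) i k B
    by apply: front => //; solve_perm W1.
  have f3 : label g (i :: A) j k B = label f (i :: (W ++ A)) j k B
    by apply: front => //; solve_perm W1.
  rewrite /hexagon; case: (ty i j k) => -[e1 e2 e3]; split; rewrite ?f1 ?f2 ?f3 ?labE //.
move=> a b c d sub; apply: (typed_fun_types hf) => x /sub xU.
by rewrite -(perm_mem WU) mem_cat xU orbT.
Qed.

(* The cell [(x, y)] lies below the path [w] when the [y]-th [false] of [w]     *)
(* precedes its [x]-th [true] (counting from 0).                               *)
Definition box (w : seq bool) x y : bool := count id (take (x + y).+1 w) <= x.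

Lemma cleP w w' : size w = size w' ->
  reflect (forall m, count id (drop m w) <= count id (drop m w')) (cle w w').
Proof.
elim: w w' => [|b w IHw] [|b' w'] //=; first by move=> _; apply: ReflectT.
case=> sz.
apply: (iffP andP) => [[le /(IHw _ sz) H] [|m] //= | H].
by split; [exact: (H 0) | apply/(IHw _ sz) => m; apply: (H m.+1)].
Qed.

Lemma cle_box a b w w' : size w = a + b -> size w' = a + b -> count id w = a -> count id w' = a ->
  cle w w' = [forall c : 'I_a * 'I_b, box w c.1 c.2 ==> box w' c.1 c.2].
Proof.
move=> sw sw' cw cw'.
have take_drop m : count id (take m w) + count id (drop m w) = a.
  by rewrite -count_cat cat_take_drop.
have take_drop' m : count id (take m w') + count id (drop m w') = a.
  by rewrite -count_cat cat_take_drop.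
apply/(cleP (etrans sw (esym sw')))/forallP => [H [x y] | H m].
  apply/implyP; rewrite /box /=; move: (H (x + y).+1) (take_drop (x + y).+1) (take_drop' (x + y).+1).
  by clear; lia.
rewrite leqNgt; apply/negP => lt.
have nneg : count negb (take m w) <= b.
  have : count negb (take m w) + count negb (drop m w) = b.
    rewrite -count_cat cat_take_drop; have := count_predC id w; rewrite cw sw => /addnI <-.
    exact: eq_count.
  by clear; lia.
have nm : count id (take m w) + count negb (take m w) = size (take m w) by rewrite count_predC.
have le' : count id (take m w') <= m.
  by apply: leq_trans (count_size _ _) _; rewrite size_take; case: ltnP.
have := take_drop m; have := take_drop' m => e1 e2.
have mn : m < size w.
  by rewrite ltnNge; apply/negP => le; move: lt; rewrite !drop_oversize // sw' -sw.
have sm : size (take m w) = m by rewrite size_take mn.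
(* With [x] the number of [true] and [y] one less than the number of [false] in the prefix of [w],
   the cell is below [w]. It is not below [w'], whose prefix of the same length has more [true]. *)
pose x := count id (take m w); pose y := m.-1 - x.
have xa : x < a by rewrite /x; move: e1 e2 lt; clear; lia.
have yb : y < b by rewrite /y /x; move: e1 e2 lt nm sm nneg le'; clear; lia.
have Em : (x + y).+1 = m by rewrite /y /x; move: e1 e2 lt nm sm nneg le'; clear; lia.
have := H (Ordinal xa, Ordinal yb); rewrite /box /= Em leqnn /x.
by move: e1 e2 lt; clear; lia.
Qed.

(** Rebuilds a word from its path and its two subwords. The default [0] is not reached when the
    lengths match the counts in [w]. *)
Fixpoint shuffle (w : seq bool) (s t : seq nat) : seq nat :=
  match w with
  | [::] => [::]
  | true :: w' => head 0 s :: shuffle w' (behead s) t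
  | false :: w' => head 0 t :: shuffle w' s (behead t)
  end.

Lemma shuffleP (p : pred nat) w s t :
    count id w = size s -> count negb w = size t -> all p s -> all (predC p) t ->
  [/\ map p (shuffle w s t) = w, filter p (shuffle w s t) = s
    & filter (predC p) (shuffle w s t) = t].
Proof.
elim: w s t => [|[] w IHw] s t /=; rewrite ?add0n ?add1n.
- by move/esym/size0nil-> => /esym/size0nil->.
- case: s => //= x s [cs] ct /andP[px ps] qt; rewrite px.
  by have [-> -> ->] := IHw s t cs ct ps qt.
case: t => //= x t cs [ct] ps /andP[/negPf px qt]; rewrite px.
by have [-> -> ->] := IHw s t cs ct ps qt.
Qed.

Lemma eq_map_filters (p : pred nat) v w : map p v = map p w -> filter p v = filter p w ->
  filter (predC p) v = filter (predC p) w -> v = w.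
Proof.
elim: v w => [|x v IHv] [|y w] // [Epx Em] /=.
by rewrite Epx; case: (p y) => /=; [case=> -> | move=> + [->]] => E1 E2; rewrite (IHv w).
Qed.

Lemma sorted_filter_cat (V : seq nat) (p : pred nat) : sorted ltn V ->
    (forall x y, x \in V -> y \in V -> p x -> ~~ p y -> x < y) ->
  V = filter p V ++ filter (predC p) V.
Proof.
move=> sV LR; apply: (irr_sorted_eq ltn_trans ltnn) => //; last first.
  by apply: perm_mem; rewrite perm_sym perm_filterC.
rewrite (sorted_pairwise ltn_trans) pairwise_cat -!(sorted_pairwise ltn_trans).
rewrite !sorted_filter ?andbT; try exact: ltn_trans; rewrite ?sV //.
by apply/allrelP => x y; rewrite !mem_filter => /andP[px xV] /andP[qy yV]; apply: LR.
Qed.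

(** * Decomposition of the order along a split of the letters *)

Section Split.

Variables (P : finType) (V : seq nat) (f : seq nat -> {set P}) (ty : nat -> nat -> nat -> bool).
Hypotheses (sV : sorted ltn V) (fV : f V = set0) (hf : typed_fun V f ty).
Variable p : pred nat.
Notation q := (predC p).
Notation L := (filter p V).
Notation R := (filter q V).
Hypothesis LR : forall x y, x \in V -> y \in V -> p x -> q y -> x < y.
Hypothesis tyL : forall i j k, {subset [:: i; j; k] <= V} -> i < j -> p i -> p j -> q k ->
  ty i j k = false.
Hypothesis tyR : forall i j k, {subset [:: i; j; k] <= V} -> j < k -> p i -> q j -> q k ->
  ty i j k = true.

Let uV : uniq V. Proof. exact: (sorted_uniq ltn_trans ltnn). Qed.

Let VE : V = L ++ R. Proof. exact: sorted_filter_cat. Qed.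

Let is_word w := perm_eq w V.
Notation label := (label f).

(** In a hexagon of type [false], the label of the two smaller letters ignores the side of the
    largest one. So the letters of R do not influence labels inside L. *)
Let move_right C A i j B : is_word ((C ++ A) ++ i :: j :: B) -> i < j -> p i -> p j -> all q C ->
  label (C ++ A) i j B = label A i j (C ++ B).
Proof.
elim: C B => // k C IHC B W ij pi pj /= /andP[qk qC].
have W1 : is_word ((C ++ A) ++ i :: j :: k :: B) by solve_perm W.
have sub : {subset [:: i; j; k] <= V}.
  by move=> x; rewrite -(perm_mem W1) !(mem_cat, inE) => /or3P[] ->; rewrite ?orbT.
have jk : j < k by apply: LR pj qk; apply: sub; rewrite !inE eqxx ?orbT.
have := typed_fun_hexagon hf W1 ij jk; rewrite tyL // => -[<- _ _].
rewrite IHC //; apply: (typed_fun_perm hf) => //; first by solve_perm W.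
by rewrite -cat1s perm_catCA.
Qed.

Let move_left C A j k B : is_word (A ++ j :: k :: (C ++ B)) -> j < k -> q j -> q k -> all p C ->
  label A j k (C ++ B) = label (C ++ A) j k B.
Proof.
elim: C A => // i C IHC A W jk qj qk /= /andP[pi pC].
have W1 : is_word (A ++ i :: j :: k :: (C ++ B)) by solve_perm W.
have sub : {subset [:: i; j; k] <= V}.
  by move=> x; rewrite -(perm_mem W1) !(mem_cat, inE) => /or3P[] ->; rewrite ?orbT.
have ij : i < j by apply: LR pi qj; apply: sub; rewrite !inE eqxx ?orbT.
have := typed_fun_hexagon hf W1 ij jk; rewrite tyR // => -[-> _ _].
rewrite IHC //; last by solve_perm W.
apply: (typed_fun_perm hf) => //; first by solve_perm W.
by rewrite perm_sym (perm_catCA C [:: i] A).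
Qed.

Let perm_filters A : perm_eq (filter p A ++ filter q A) A.
Proof. by rewrite perm_filterC. Qed.

Let labelL A i j B : is_word (A ++ i :: j :: B) -> i < j -> p i -> p j ->
  label A i j B = label (filter p A) i j (filter p B ++ R).
Proof.
move=> W ij pi pj.
have W1 : is_word ((filter q A ++ filter p A) ++ i :: j :: B).
  by apply: perm_trans W; rewrite perm_cat2r perm_catC.
rewrite (typed_fun_perm hf (A' := filter q A ++ filter p A) (B' := B) W) //; last first.
  by rewrite perm_catC.
rewrite move_right ?filter_all //; apply: (typed_fun_perm hf) => //; first by solve_perm W1.
apply: (@perm_trans _ (filter p B ++ (filter q A ++ filter q B))).
  rewrite perm_cat2l perm_sym.
  by have := perm_filter q W; rewrite filter_cat /= pi pj.
by rewrite perm_catCA perm_cat2l.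
Qed.

Let labelR A j k B : is_word (A ++ j :: k :: B) -> j < k -> q j -> q k ->
  label A j k B = label (L ++ filter q A) j k (filter q B).
Proof.
move=> W jk qj qk.
have W1 : is_word (A ++ j :: k :: (filter p B ++ filter q B)).
  by apply: perm_trans W; rewrite perm_cat2l !perm_cons.
rewrite (typed_fun_perm hf (A' := A) (B' := filter p B ++ filter q B) W) //.
rewrite move_left ?filter_all //; apply: (typed_fun_perm hf) => //; first by solve_perm W1.
apply: (@perm_trans _ ((filter p A ++ filter p B) ++ filter q A)).
  rewrite perm_cat2r; move: qj qk => /= /negPf nj /negPf nk.
  by have := perm_filter p W; rewrite !filter_cat /= nj nk perm_sym.
by rewrite -catA perm_catCA perm_cat2l.
Qed.

Let mem_word (X Y : seq nat) : is_word Y -> {subset X <= Y} -> {subset X <= V}.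
Proof. by move=> W sub x xX; rewrite -(perm_mem W) sub. Qed.

(** The crossing letter of L may be traded with another letter of L. The statement is symmetric in
    [i] and [j], which is what [marked_perm] requires. *)
Let hexagonL X i j k Y : is_word (X ++ i :: j :: k :: Y) -> p i -> p j -> q k ->
  label (j :: X) i k Y = label (i :: X) j k Y /\ label X i k (j :: Y) = label X j k (i :: Y).
Proof.
move=> W pi pj qk; have sub : {subset [:: i; j; k] <= V}.
  apply: (mem_word W) => x; rewrite !(mem_cat, inE) => /or3P[] ->; rewrite ?orbT //.
have sub' : {subset [:: j; i; k] <= V}.
  by move=> x xin; apply: sub; move: xin; rewrite !inE orbCA.
have ik : i < k by apply: LR pi qk; apply: sub; rewrite !inE eqxx ?orbT.
have jk : j < k by apply: LR pj qk; apply: sub; rewrite !inE eqxx ?orbT.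
have [ij | ji | -> //] := ltngtP i j.
  by have := typed_fun_hexagon hf W ij jk; rewrite tyL // => -[_ e1 e2].
have W' : is_word (X ++ j :: i :: k :: Y) by solve_perm W.
by have := typed_fun_hexagon hf W' ji ik; rewrite tyL // => -[_ e1 e2].
Qed.

Let hexagonR X i j k Y : is_word (X ++ i :: j :: k :: Y) -> p i -> q j -> q k ->
  label X i j (k :: Y) = label X i k (j :: Y) /\ label (k :: X) i j Y = label (j :: X) i k Y.
Proof.
move=> W pi qj qk; have sub : {subset [:: i; j; k] <= V}.
  apply: (mem_word W) => x; rewrite !(mem_cat, inE) => /or3P[] ->; rewrite ?orbT //.
have sub' : {subset [:: i; k; j] <= V}.
  by move=> x xin; apply: sub; move: xin; rewrite !inE [(x == k) || _]orbC.
have ik : i < k by apply: LR pi qk; apply: sub; rewrite !inE eqxx ?orbT.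
have ij : i < j by apply: LR pi qj; apply: sub; rewrite !inE eqxx ?orbT.
have [jk | kj | -> //] := ltngtP j k.
  by have := typed_fun_hexagon hf W ij jk; rewrite tyR // => -[_ e1 e2].
have W' : is_word (X ++ i :: k :: j :: Y) by solve_perm W.
by have := typed_fun_hexagon hf W' ik kj; rewrite tyR // => -[_ e1 e2].
Qed.

(** A normal form for the steps that exchange a letter of L with one of R, having [x] letters of L
    and [y] of R on their left. *)
Let cross x y := label (take x L ++ take y R) (nth 0 L x) (nth 0 R y)
  (drop x.+1 L ++ drop y.+1 R).

Let word_LR C i D A k B : perm_eq (C ++ i :: D) L -> perm_eq (A ++ k :: B) R ->
  is_word ((C ++ A) ++ i :: k :: (D ++ B)).
Proof.
move=> WL WR; rewrite /is_word [V in perm_eq _ V]VE.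
apply: (@perm_trans _ ((C ++ i :: D) ++ (A ++ k :: B))); first by count_perm.
exact: perm_cat.
Qed.

Let nth_split (s : seq nat) x : x < size s -> take x s ++ nth 0 s x :: drop x.+1 s = s.
Proof. by move=> xs; rewrite -drop_nth // cat_take_drop. Qed.

Let mem_filter_perm (a : pred nat) C i D : perm_eq (C ++ i :: D) (filter a V) ->
  all a (C ++ i :: D).
Proof. by move/perm_all->; apply: filter_all. Qed.

Let ltLR i k : i \in L -> k \in R -> i < k.
Proof. by rewrite !mem_filter => /andP[pi iV] /andP[qk kV]; apply: LR. Qed.

(** Two uses of [marked_perm]: rearrange the letters of L with those of R fixed, then the letters of
    R. *)
Let labelX A i k B : is_word (A ++ i :: k :: B) -> p i -> q k ->
  label A i k B = cross (count p A) (count q A).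
Proof.
move=> W pi qk.
have WL : perm_eq (filter p A ++ i :: filter p B) L.
  by have := perm_filter p W; rewrite filter_cat /= pi (negPf qk).
have WR : perm_eq (filter q A ++ k :: filter q B) R.
  by have := perm_filter q W; rewrite filter_cat /= pi (negPf qk).
have iL C j D : perm_eq (C ++ j :: D) L -> j \in L.
  by move/perm_mem <-; rewrite mem_cat mem_head orbT.
have kR C j D : perm_eq (C ++ j :: D) R -> j \in R.
  by move/perm_mem <-; rewrite mem_cat mem_head orbT.
have xL : count p A < size L by rewrite -(perm_size WL) size_cat size_filter /= addnS ltnS leq_addr.
have yR : count q A < size R by rewrite -(perm_size WR) size_cat size_filter /= addnS ltnS leq_addr.
have sL := nth_split xL; have sR := nth_split yR.
transitivity (label (filter p A ++ filter q A) i k (filter p B ++ filter q B)).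
  by apply: (typed_fun_perm hf) => //; apply: ltLR (iL _ _ _ WL) (kR _ _ _ WR).
transitivity (label (take (count p A) L ++ filter q A) (nth 0 L (count p A)) k
    (drop (count p A).+1 L ++ filter q B)).
  apply: (marked_perm (h := fun C i D => label (C ++ filter q A) i k (D ++ filter q B)) (s0 := L)) => //.
  - move=> C C' j D D' WC CC DD; apply: (typed_fun_perm hf) => //; rewrite ?perm_cat2r //.
      exact: word_LR.
    exact: ltLR (iL _ _ _ WC) (kR _ _ _ WR).
  - move=> C a j D WC; have Wx := word_LR WC WR.
    have := mem_filter_perm WC; rewrite all_cat /= => /and4P[_ pa pj _].
    have [| //] := @hexagonL (C ++ filter q A) j a k (D ++ filter q B) _ pj pa qk.
    by solve_perm Wx.
  - move=> C j b D WC; have Wx := word_LR WC WR.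
    have := mem_filter_perm WC; rewrite all_cat /= => /and4P[_ pj pb _].
    have [| //] := @hexagonL (C ++ filter q A) j b k (D ++ filter q B) _ pj pb qk.
    by solve_perm Wx.
  - by rewrite sL.
  by rewrite size_takel; [rewrite size_filter | apply: ltnW].
have {}sL : perm_eq (take (count p A) L ++ nth 0 L (count p A) :: drop (count p A).+1 L) L.
  by rewrite sL.
have pL : p (nth 0 L (count p A)).
  by have := mem_filter_perm sL; rewrite all_cat /= => /and3P[].
rewrite /cross.
move: (take _ L) (nth 0 L _) (drop _ L) sL pL => C j D WC pj.
apply: (marked_perm (h := fun A' k' B' => label (C ++ A') j k' (D ++ B')) (s0 := R)) => //.
- move=> A1 A2 k1 B1 B2 WA AA BB; apply: (typed_fun_perm hf) => //; rewrite ?perm_cat2l //.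
    exact: word_LR.
  exact: ltLR (iL _ _ _ WC) (kR _ _ _ WA).
- move=> A1 a k1 B1 WA; have Wx := word_LR WC WA.
  have := mem_filter_perm WA; rewrite all_cat [all q (a :: _)]/= => /and4P[_ qa qk1 _].
  have W1 : is_word ((C ++ A1) ++ j :: a :: k1 :: (D ++ B1)) by solve_perm Wx.
  have W2 : is_word ((C ++ A1) ++ j :: k1 :: a :: (D ++ B1)) by solve_perm Wx.
  have W3 : is_word (a :: (C ++ A1) ++ j :: k1 :: (D ++ B1)) by solve_perm Wx.
  have W4 : is_word (k1 :: (C ++ A1) ++ j :: a :: (D ++ B1)) by solve_perm Wx.
  have jk1 : j < k1 by apply: ltLR (iL _ _ _ WC) _; rewrite -(perm_mem WA) mem_cat !inE eqxx !orbT.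
  have ja : j < a by apply: ltLR (iL _ _ _ WC) _; rewrite -(perm_mem WA) mem_cat !inE eqxx !orbT.
  rewrite -(typed_fun_perm hf (A := a :: (C ++ A1)) (B := D ++ B1) W3 jk1) //; last first.
    by rewrite -[a :: A1]cat1s perm_catCA.
  rewrite -(typed_fun_perm hf (A := k1 :: (C ++ A1)) (B := D ++ B1) W4 ja) //; last first.
    by rewrite -[k1 :: A1]cat1s perm_catCA.
  by have [_] := hexagonR W1 pj qa qk1.
- move=> A1 k1 b B1 WA; have Wx := word_LR WC WA.
  have := mem_filter_perm WA; rewrite all_cat [all q (k1 :: _)]/= => /and4P[_ qk1 qb _].
  have W1 : is_word ((C ++ A1) ++ j :: k1 :: b :: (D ++ B1)) by solve_perm Wx.
  have W3 : is_word ((C ++ A1) ++ j :: k1 :: (b :: (D ++ B1))) by solve_perm Wx.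
  have W4 : is_word ((C ++ A1) ++ j :: b :: (k1 :: (D ++ B1))) by solve_perm Wx.
  have jk1 : j < k1 by apply: ltLR (iL _ _ _ WC) _; rewrite -(perm_mem WA) mem_cat !inE eqxx !orbT.
  have jb : j < b by apply: ltLR (iL _ _ _ WC) _; rewrite -(perm_mem WA) mem_cat !inE eqxx !orbT.
  rewrite -(typed_fun_perm hf W3 jk1) //; last by rewrite -[b :: B1]cat1s perm_catCA.
  rewrite -(typed_fun_perm hf W4 jb) //; last by rewrite -[k1 :: B1]cat1s perm_catCA.
  by have [] := hexagonR W1 pj qk1 qb.
- by rewrite sR.
by rewrite size_takel; [rewrite size_filter | apply: ltnW].
Qed.

Let funL u := f (u ++ R).
Let funR u := f (L ++ u).

Let crosses w := \bigcup_(b : 'I_(size L) * 'I_(size R) | box w b.1 b.2) cross b.1 b.2.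

Let f_step A i j B : is_word (A ++ i :: j :: B) -> i < j ->
  f (A ++ j :: i :: B) = f (A ++ i :: j :: B) :|: label A i j B.
Proof.
move=> W ij; have [/setUidPr sub _] := typed_fun_step hf W ij.
by rewrite /label -[LHS]sub; apply/setP=> x; rewrite !inE; case: (x \in _).
Qed.

Let box_step (A B : seq bool) x y :
  box (A ++ false :: true :: B) x y =
  box (A ++ true :: false :: B) x y || (x == count id A) && (y == count negb A).
Proof.
rewrite /box; have szA : size A = count id A + count negb A.
  by rewrite -(count_predC id A).
rewrite !take_cat; case: ltnP => [xyA | Axy].
  by rewrite [X in _ || X](_ : _ = false) ?orbF //; move: szA xyA; clear; lia.
have := subnKC Axy; rewrite !count_cat; move: (_ - _) => [|[|k]] /= E.
- by rewrite [X in _ || X](_ : _ = false) ?orbF //; move: szA E; clear; lia.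
- by move: szA E; move: (count id A) (count negb A) => c d; clear; lia.
by rewrite [X in _ || X](_ : _ = false) ?orbF; move: szA E; clear; lia.
Qed.

Let crosses_step (A B : seq bool) : count id A < size L -> count negb A < size R ->
  crosses (A ++ false :: true :: B) = crosses (A ++ true :: false :: B) :|: cross (count id A) (count negb A).
Proof.
move=> xL yR; apply/setP => z; rewrite inE; apply/bigcupP/orP => [[[x y] /= bxy zxy]|].
  move: bxy; rewrite box_step => /orP[bxy | /andP[/eqP Ex /eqP Ey]].
    by left; apply/bigcupP; exists (x, y).
  by right; rewrite -Ex -Ey.
case=> [/bigcupP[[x y] /= bxy zxy] | zxy].
  by exists (x, y); rewrite //= box_step bxy.
by exists (Ordinal xL, Ordinal yR); rewrite //= box_step !eqxx orbT.
Qed.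

Let crosses_sorted : crosses (map p V) = set0.
Proof.
rewrite /crosses big_pred0 // => -[x y]; rewrite /box [in map p V]VE map_cat.
have -> : map p L = nseq (size L) true.
  by rewrite -(size_map p L); apply/all_pred1P; rewrite all_map;
    apply: sub_all (filter_all p V) => k /= ->.
have -> : map p R = nseq (size R) false.
  by rewrite -(size_map p R); apply/all_pred1P; rewrite all_map;
    apply: sub_all (filter_all q V) => k /= /negPf->.
rewrite take_cat size_nseq; case: ltnP => xy.
  rewrite take_nseq; last exact: ltnW.
  by rewrite count_nseq mul1n; apply/negbTE; rewrite -ltnNge ltnS leq_addr.
by rewrite count_cat count_nseq mul1n; apply/negbTE; rewrite -ltnNge (ltn_addr _ (ltn_ord x)).
Qed.

(** Each adjacent swap adds its label to exactly one of the three pieces, according to the sides of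
    its letters; an ascent from R to L is excluded by [LR]. *)
Let f_split w : is_word w ->
  f w = funL (filter p w) :|: funR (filter q w) :|: crosses (map p w).
Proof.
move: w; apply: word_ind => //.
  by rewrite /funL /funR crosses_sorted -VE fV !setU0.
move=> A i j B W ij IH; rewrite f_step // IH.
have sub : {subset [:: i; j] <= V}.
  by apply: (mem_word W) => x; rewrite !(mem_cat, inE) => /orP[] ->; rewrite ?orbT.
have [iV jV] : i \in V /\ j \in V by split; apply: sub; rewrite !inE eqxx ?orbT.
have W' : is_word (A ++ j :: i :: B) by solve_perm W.
rewrite !filter_cat !map_cat /=.
case pj: (p j); case pi: (p i) => /=.
- have WL : is_word (filter p A ++ i :: j :: (filter p B ++ R)).
    rewrite /is_word [V in perm_eq _ V]VE.
    have := perm_filter p W; rewrite filter_cat /= pi pj => WL.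
    by rewrite -(perm_cat2r R) -catA in WL.
  rewrite labelL // /funL -!catA /= (f_step WL ij).
  by apply/setP=> x; rewrite !inE; do !case: (x \in _).
- by have := LR jV iV pj (negbT pi); rewrite ltnNge ltnW.
- have -> : label A i j B = cross (count id (map p A)) (count negb (map p A)).
    by rewrite labelX //= ?pi ?pj // !count_map.
  have xL : count id (map p A) < size L.
    have := perm_filter p W; rewrite filter_cat /= pi pj => /perm_size <-.
    by rewrite size_cat count_map size_filter /= addnS ltnS leq_addr.
  have yR : count negb (map p A) < size R.
    have := perm_filter q W; rewrite filter_cat /= pi pj => /perm_size <-.
    by rewrite size_cat count_map size_filter /= addnS ltnS leq_addr.
  rewrite crosses_step // !count_map.
  by apply/setP=> x; rewrite !inE; do !case: (x \in _).
have WR : is_word ((L ++ filter q A) ++ i :: j :: filter q B).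
  rewrite /is_word [V in perm_eq _ V]VE -catA.
  have := perm_filter q W; rewrite filter_cat /= pi pj => WR.
  by rewrite perm_cat2l.
have E : funR (filter q A ++ j :: i :: filter q B) =
    funR (filter q A ++ i :: j :: filter q B) :|: label A i j B.
  have [qi qj] : q i /\ q j by rewrite /= pi pj.
  by rewrite (labelR W ij qi qj) /funR; have := f_step WR ij; rewrite -!catA.
rewrite [funR (_ ++ j :: _)]E.
by apply/setP=> x; rewrite !inE; do !case: (x \in _).
Qed.

Let sL : sorted ltn L. Proof. exact: (sorted_filter ltn_trans). Qed.
Let sR : sorted ltn R. Proof. exact: (sorted_filter ltn_trans). Qed.

Let hfL : typed_fun L funL ty.
Proof. by apply: typed_fun_suffix hf _; rewrite -VE. Qed.

Let hfR : typed_fun R funR ty.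
Proof. by apply: typed_fun_prefix hf _; rewrite -VE. Qed.

Let funL0 : funL L = set0. Proof. by rewrite /funL -VE. Qed.
Let funR0 : funR R = set0. Proof. by rewrite /funR -VE. Qed.

Let part (o : bool + 'I_(size L) * 'I_(size R)) : {set P} :=
  match o with
  | inl true => funL (rev L)
  | inl false => funR (rev R)
  | inr b => cross b.1 b.2
  end.

Let card_cross (x : 'I_(size L)) (y : 'I_(size R)) : #|cross x y| = 1.
Proof.
have [sLx sRy] := (nth_split (ltn_ord x), nth_split (ltn_ord y)).
have := @word_LR (take x L) (nth 0 L x) (drop x.+1 L) (take y R) (nth 0 R y) (drop y.+1 R).
rewrite sLx sRy => /(_ (perm_refl _) (perm_refl _)) W.
by have [] := typed_fun_step hf W (ltLR (mem_nth 0 (ltn_ord x)) (mem_nth 0 (ltn_ord y))).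
Qed.

Let bin2_add a b : 'C(a + b, 2) = 'C(a, 2) + 'C(b, 2) + a * b.
Proof.
elim: a => [|a IHa]; first by rewrite add0n bin0n mul0n addn0.
by rewrite addSn !binS !bin1 IHa mulSn; clear; lia.
Qed.

Let inv_rev_sorted s : sorted ltn s -> inv (rev s) = 'C(size s, 2).
Proof.
by move=> ss; rewrite -inv_rev ?(sorted_uniq ltn_trans ltnn) // (inv_sorted ss).
Qed.

(** The parts cover the set of the reversed word, whose cardinality ['C(a + b, 2) = 'C(a, 2) + 'C(b,
    2) + a * b] is the sum of theirs: there is no room for an overlap. *)
Let part_disjoint o o' z : z \in part o -> z \in part o' -> o = o'.
Proof.
apply: eq_of_card_bigcup.
have le : f (rev V) \subset \bigcup_o part o.
  have Wr : is_word (rev V) by rewrite /is_word perm_rev.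
  rewrite (f_split Wr) !filter_rev; apply/subsetP => x.
  rewrite !inE -orbA => /or3P[xL | xR | /bigcupP[b _ xb]]; apply/bigcupP.
  - by exists (inl true).
  - by exists (inl false).
  by exists (inr b).
apply: leq_trans (subset_leq_card le).
rewrite (typed_fun_card sV fV hf) ?perm_rev // inv_rev_sorted //.
rewrite big_sumType /= big_bool /=.
rewrite (typed_fun_card sL funL0 hfL) ?perm_rev // inv_rev_sorted //.
rewrite (typed_fun_card sR funR0 hfR) ?perm_rev // inv_rev_sorted //.
rewrite (eq_bigr (fun=> 1)) => [|b _]; last exact: card_cross.
by rewrite sum1_card card_prod !card_ord [in size V]VE size_cat bin2_add.
Qed.

Let crosses_sub w w' : (crosses w \subset crosses w') =
  [forall b : 'I_(size L) * 'I_(size R), box w b.1 b.2 ==> box w' b.1 b.2].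
Proof.
apply/idP/forallP => [sub b | sub]; last first.
  by apply/bigcupsP => b bw; apply: (bigcup_sup b) => //; apply: (implyP (sub b)).
apply/implyP => bw; have /card_gt0P[z zb] : 0 < #|cross b.1 b.2| by rewrite card_cross.
have : z \in crosses w' by apply: (subsetP sub); apply/bigcupP; exists b.
case/bigcupP => b' bw' zb'.
by have [->] : inr b = inr b' :> bool + _ by apply: (part_disjoint (z := z)).
Qed.

Let f_subset v w : is_word v -> is_word w -> (f v \subset f w) =
  [&& crosses (map p v) \subset crosses (map p w),
      funL (filter p v) \subset funL (filter p w)
    & funR (filter q v) \subset funR (filter q w)].
Proof.
move=> Wv Ww; rewrite !f_split // !subUset -andbA.
have inL u z : is_word u -> z \in funL (filter p u) -> z \in part (inl true).
  move=> Wu; have sub : funL (filter p u) \subset part (inl true).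
    exact: (typed_fun_max sL hfL (perm_filter p Wu)).
  exact: (subsetP sub).
have inR u z : is_word u -> z \in funR (filter q u) -> z \in part (inl false).
  move=> Wu; have sub : funR (filter q u) \subset part (inl false).
    exact: (typed_fun_max sR hfR (perm_filter q Wu)).
  exact: (subsetP sub).
apply/and3P/and3P => -[H1 H2 H3].
  split; apply/subsetP => z zv.
  - have := subsetP H3 z zv; rewrite !inE -orbA => /or3P[] // zw; case/bigcupP: zv => b _ zb.
      by have := part_disjoint (o := inr b) zb (inL _ _ Ww zw).
    by have := part_disjoint (o := inr b) zb (inR _ _ Ww zw).
  - have := subsetP H1 z zv; rewrite !inE -orbA => /or3P[] // zw.
      by have := part_disjoint (inL _ _ Wv zv) (inR _ _ Ww zw).
    case/bigcupP: zw => b _ zb.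
    by have := part_disjoint (o := inr b) zb (inL _ _ Wv zv).
  have := subsetP H2 z zv; rewrite !inE -orbA => /or3P[] // zw.
    by have := part_disjoint (inR _ _ Wv zv) (inL _ _ Ww zw).
  case/bigcupP: zw => b _ zb.
  by have := part_disjoint (o := inr b) zb (inR _ _ Wv zv).
split.
- by rewrite -setUA; apply: subset_trans H2 (subsetUl _ _).
- by apply: subset_trans H3 _; rewrite -setUA setUCA subsetUl.
by apply: subset_trans H1 (subsetUr _ _).
Qed.

Lemma all_mchains_split c :
  all_mchains (permutations V) (fun v w => f v \subset f w) c =
  all_mchains (paths (size L) (size R)) cle c *
    (all_mchains (permutations L) (fun v w => f (v ++ R) \subset f (w ++ R)) c *
     all_mchains (permutations R) (fun v w => f (L ++ v) \subset f (L ++ w)) c).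
Proof.
pose h v := (map p v, (filter p v, filter q v)).
have cnt_map v : is_word v -> [/\ size (map p v) = size L + size R,
    count id (map p v) = size L & count negb (map p v) = size R].
  move=> Wv; rewrite size_map (perm_size Wv) !count_map.
  have /seq.permP cV := Wv; rewrite (cV p) (cV q) !size_filter.
  by rewrite count_predC.
rewrite -!all_mchains_prod.
set r := prod_rel _ _; rewrite -(@all_mchains_map _ _ h (permutations V) _ r).
  apply: all_mchains_perm; apply: uniq_perm.
  - rewrite map_inj_in_uniq ?permutations_uniq // => v w _ _ [].
    exact: eq_map_filters.
  - apply: allpairs_uniq; rewrite ?filter_uniq ?lists_uniq //; last by move=> [? ?] [? ?].
    by apply: allpairs_uniq; rewrite ?permutations_uniq // => -[? ?] [? ?].
  move=> [w [u v]]; apply/mapP/allpairsP => /=.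
    case=> z; rewrite mem_permutations => Wz [-> -> ->].
    exists (map p z, (filter p z, filter q z)); split=> //=.
      have [sz cz _] := cnt_map z Wz.
      rewrite mem_filter cz eqxx mem_lists size_map -(size_map p z) sz eqxx /=.
      by apply/allP => -[] _; rewrite !inE.
    by apply/allpairsP; exists (filter p z, filter q z); rewrite !mem_permutations !perm_filter.
  case=> -[w' uv] [/= + + [-> ->]]; rewrite mem_filter mem_lists => /andP[/eqP cw /andP[/eqP sw _]].
  case/allpairsP => -[u' v'] [/=]; rewrite !mem_permutations => pu pv ->.
  have cnw : count negb w' = size v'.
    rewrite (perm_size pv); have := count_predC id w'; rewrite cw sw => /addnI <-.
    exact: eq_count.
  have [] := @shuffleP p w' u' v' _ cnw.
  - by rewrite cw (perm_size pu).
  - by rewrite (perm_all _ pu) filter_all.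
  - by rewrite (perm_all _ pv) filter_all.
  move=> e1 e2 e3; exists (shuffle w' u' v'); last by rewrite /h e1 e2 e3.
  rewrite mem_permutations -(permPl (perm_filters _)) e2 e3 [V in perm_eq _ V]VE.
  exact: perm_cat.
move=> v w; rewrite !mem_permutations => Wv Ww; rewrite /r /prod_rel /= f_subset //.
have [[sv cv _] [sw cw _]] := (cnt_map v Wv, cnt_map w Ww).
by rewrite crosses_sub (cle_box sv sw cv cw).
Qed.

End Split.

(** * Choice of the split *)

Section Root.

Variables (P : finType) (V : seq nat) (f : seq nat -> {set P}) (ty : nat -> nat -> nat -> bool).
Hypotheses (sV : sorted ltn V) (hf : typed_fun V f ty) (V2 : 1 < size V).

Let mn := head 0 V.
Let mx := last 0 V.

(* The triples [mn < j < mx] decide on which side of the root gap [j] lies.    *)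
Definition left_of_root (j : nat) : bool := (j == mn) || (j != mx) && ~~ ty mn j mx.

Let bounds x : x \in V -> mn <= x <= mx.
Proof.
move=> xV; have V0 : 0 < size V by apply: ltnW.
rewrite /mn /mx -nth0 -nth_last -(nth_index 0 xV).
have ltV := sorted_leq_nth leq_trans leqnn 0 (sub_sorted ltnW sV).
have iV : index x V < size V by rewrite index_mem.
have lV : (size V).-1 < size V by rewrite prednK.
by rewrite !ltV ?inE // -ltnS prednK.
Qed.

Let mnV : mn \in V.
Proof. by rewrite /mn -nth0 mem_nth // ltnW. Qed.
Let mxV : mx \in V.
Proof. by rewrite /mx -nth_last mem_nth // prednK // ltnW. Qed.
Let mnx : mn < mx.
Proof.
rewrite /mn /mx -nth0 -nth_last; apply: (sorted_ltn_nth ltn_trans 0 sV); rewrite ?inE //.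
- exact: ltnW.
- by rewrite prednK // ltnW.
by rewrite -ltnS prednK // ltnW.
Qed.

Let quad a b c d : a \in V -> b \in V -> c \in V -> d \in V -> a < b -> b < c -> c < d ->
  (ty a b c, ty a b d, ty a c d, ty b c d) \in
    [:: (false, false, false, false); (false, false, true, true);
        (true, false, false, false); (true, true, true, false);
        (true, true, true, true)].
Proof.
move=> aV bV cV dV; apply: (typed_fun_types hf) => x.
by rewrite !inE => /or4P[] /eqP->.
Qed.

Let gt_mn x : x \in V -> x != mn -> mn < x.
Proof. by move=> /bounds/andP[le _]; rewrite ltn_neqAle eq_sym le andbT. Qed.
Let lt_mx x : x \in V -> x != mx -> x < mx.
Proof. by move=> /bounds/andP[_ le]; rewrite ltn_neqAle le andbT. Qed.

(** Otherwise the quadruple [mn < y < x < mx] would have second type [true] and third type [false],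
    and no admissible pattern does. *)
Lemma left_of_root_lt x y : x \in V -> y \in V -> left_of_root x -> ~~ left_of_root y -> x < y.
Proof.
move=> xV yV px qy; rewrite ltnNge leq_eqVlt; apply/negP => /orP[/eqP E | yx].
  by rewrite -E (negPf qy) in px.
move: px qy; rewrite /left_of_root.
have [E | nxm /= /andP[nxM tx]] := eqVneq x mn.
  by move: yx; rewrite E ltnNge; case/andP: (bounds yV) => ->.
rewrite negb_or negb_and => /andP[nym].
have -> : y != mx by rewrite neq_ltn (ltn_trans yx (lt_mx xV nxM)).
move=> /= ty'; have := quad mnV yV xV mxV (gt_mn yV nym) yx (lt_mx xV nxM).
by move: tx ty'; case: (ty mn x mx); case: (ty mn y mx); rewrite // !inE !xpair_eqE /= ?andbF.
Qed.

(** On [mn < j < k < mx] the second type is [false] and the third [true], which makes the first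
    [false]. This is the third type on [mn < i < j < k], where it forces the fourth to be
    [false]. *)
Lemma left_of_rootL i j k : {subset [:: i; j; k] <= V} -> i < j ->
  left_of_root i -> left_of_root j -> ~~ left_of_root k -> ty i j k = false.
Proof.
move=> sub ij pi pj qk.
have [iV jV kV] : [/\ i \in V, j \in V & k \in V] by split; apply: sub; rewrite !inE eqxx ?orbT.
have jk := left_of_root_lt jV kV pj qk.
have nj : j != mn by rewrite neq_ltn orbC (leq_ltn_trans _ ij) //; case/andP: (bounds iV).
move: (pj); rewrite /left_of_root (negPf nj) /= => /andP[njM /negPf tj].
have mnj : ty mn j k = false.
  have [-> // | nkM] := eqVneq k mx.
  move: (qk); rewrite /left_of_root negb_or nkM negbK => /andP[nkm tk].
  have := quad mnV jV kV mxV (gt_mn jV nj) jk (lt_mx kV nkM).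
  by rewrite tj tk; case: (ty mn j k); rewrite // !inE !xpair_eqE /= ?andbF.
have [-> // | ni] := eqVneq i mn.
have := quad mnV iV jV kV (gt_mn iV ni) ij jk.
by rewrite mnj; case: (ty i j k); rewrite // !inE !xpair_eqE /= ?andbF.
Qed.

(** The mirror argument: [mn < i < j < mx] gives the type of [i, j, mx], and then [i < j < k < mx]
    that of [i, j, k]. *)
Lemma left_of_rootR i j k : {subset [:: i; j; k] <= V} -> j < k ->
  left_of_root i -> ~~ left_of_root j -> ~~ left_of_root k -> ty i j k = true.
Proof.
move=> sub jk pi qj qk.
have [iV jV kV] : [/\ i \in V, j \in V & k \in V] by split; apply: sub; rewrite !inE eqxx ?orbT.
have ij := left_of_root_lt iV jV pi qj.
have njM : j != mx by rewrite neq_ltn (leq_trans jk) //; case/andP: (bounds kV).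
move: (qj); rewrite /left_of_root negb_or njM negbK => /andP[njm tj].
have tiM : ty i j mx = true.
  have [-> // | ni] := eqVneq i mn.
  move: (pi); rewrite /left_of_root (negPf ni) /= => /andP[niM /negPf ti].
  have := quad mnV iV jV mxV (gt_mn iV ni) ij (lt_mx jV njM).
  by rewrite ti tj; case: (ty i j mx); rewrite // !inE !xpair_eqE /= ?andbF.
have [-> // | nkM] := eqVneq k mx.
have := quad iV jV kV mxV ij jk (lt_mx kV nkM).
by rewrite tiM; case: (ty i j k); rewrite // !inE !xpair_eqE /= ?andbF.
Qed.

Lemma left_of_root_head : left_of_root mn.
Proof. by rewrite /left_of_root eqxx. Qed.

Lemma left_of_root_last : ~~ left_of_root mx.
Proof. by rewrite /left_of_root eqxx /= orbF neq_ltn mnx orbT. Qed.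

Lemma root_split : [/\ mn \in filter left_of_root V & mx \in filter (predC left_of_root) V].
Proof.
by rewrite !mem_filter mnV mxV left_of_root_head /= left_of_root_last.
Qed.

End Root.

(** * The number of multichains *)

Lemma all_mchains1 (T : Type) (x : T) (r : rel T) c : r x x -> all_mchains [:: x] r c = 1.
Proof.
move=> rxx; have mE k y : r y x -> mchains [:: x] r k y = 1.
  by elim: k y => //= k IHk y ryx; rewrite big_cons big_nil ryx IHk.
by case: c => //= c; rewrite big_seq1 mE.
Qed.

Theorem typed_fun_count (P : finType) (V : seq nat) (f : seq nat -> {set P}) ty c :
  sorted ltn V -> f V = set0 -> typed_fun V f ty ->
  all_mchains (permutations V) (fun v w => f v \subset f w) c = staircase_count c (size V).
Proof.
have [m] := ubnP (size V); elim: m V f => // m IHm V f ltm sV fV hf.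
have [V2 | V1] := ltnP 1 (size V); last first.
  case: V V1 {ltm sV fV hf} => [|x [|//]] _; rewrite all_mchains1 ?subxx //.
    by rewrite /staircase_count big_ord0.
  by rewrite /staircase_count big_ord_recl big_ord0 bin0.
pose p := left_of_root V ty.
have LR x y := @left_of_root_lt _ _ _ _ sV hf V2 x y.
have tyL i j k := @left_of_rootL _ _ _ _ sV hf V2 i j k.
have tyR i j k := @left_of_rootR _ _ _ _ sV hf V2 i j k.
have [mnL mxR] := root_split ty sV V2.
have L0 : 0 < size (filter p V) by case: (filter p V) mnL.
have R0 : 0 < size (filter (predC p) V) by case: (filter (predC p) V) mxR.
have VE : V = filter p V ++ filter (predC p) V by apply: sorted_filter_cat.
have szV : size V = size (filter p V) + size (filter (predC p) V) by rewrite {1}VE size_cat.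
rewrite (all_mchains_split sV fV hf LR tyL tyR) szV -all_mchains_paths_staircase.
congr (_ * (_ * _)).
- apply: (IHm _ (fun u => f (u ++ _))).
  + by rewrite ltnS in ltm; apply: leq_trans ltm; rewrite szV -addn1 leq_add2l.
  + exact: (sorted_filter ltn_trans).
  + by rewrite -VE.
  by apply: typed_fun_suffix hf _; rewrite -VE.
apply: (IHm _ (fun u => f (_ ++ u))).
- by rewrite ltnS in ltm; apply: leq_trans ltm; rewrite szV -add1n leq_add2r.
- exact: (sorted_filter ltn_trans).
- by rewrite -VE.
by apply: typed_fun_prefix hf _; rewrite -VE.
Qed.

Import GRing.Theory.
Local Open Scope ring_scope.

Theorem proposition5p2 (l n : nat) (hl : (1 <= l)%N) (hn : (1 <= n)%N)
    (r : rel 'S_n) (hr : middle_order r) :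
  #|complete_chains r l|%:Z =
    \sum_(0 <= k < l.+1)
      (-1) ^+ (l - k) * 'C(l, k)%:Z * \prod_(0 <= i < n) 'C(k + i - 1, i)%:Z.
Proof.
have [f [mf f0 rE]] := middle_order_fun hr.
have sV := iota_ltn_sorted 0 n.
have tf := typed_of_middle (iota_uniq 0 n) mf.
have r_anti : antisymmetric r.
  move=> v w; rewrite !rE -eqEsubset => /eqP/(middle_fun_inj mf (perm_word v) (perm_word w)).
  exact: word_inj.
have [t wt] : exists t : 'S_n, word t = rev (iota 0 n).
  by apply: word_surj; rewrite perm_rev.
have r_bot v : r 1%g v by rewrite rE word1 f0 sub0set.
have r_top v : r v t by rewrite rE wt (typed_fun_max sV tf) ?perm_word.
have r_refl : reflexive r by move=> v; rewrite rE.
have r_trans : transitive r by move=> v u w; rewrite !rE; apply: subset_trans.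
rewrite (card_complete_chains r_refl r_trans r_anti r_bot r_top) big_mkord.
apply: eq_bigr => k _; congr (_ * _).
rewrite -(big_morph Posz PoszM (erefl _)) big_mkord; congr Posz.
case: (nat_of_ord k) => [|k'].
  (* The term [k = 0] must be 1 when bottom and top coincide, that is for [n = 1], and 0 otherwise.
     The factor [i = 0] is ['C(0, 0) = 1] by truncated subtraction, in accordance with the
     convention, and the factor [i = 1] is ['C(0, 1) = 0]. *)
  have -> : (1%g == t) = (iota 0 n == rev (iota 0 n)).
    by rewrite -wt -word1 (inj_eq (@word_inj n)).
  case: (n) hn => [//|[|m]] _; first by rewrite big_ord_recl big_ord0.
  have -> : (\prod_(i < m.+2) 'C(0 + i - 1, i) = 0)%N.
    by rewrite !big_ord_recl /= mul0n muln0.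
  case: eqP => // /(congr1 (fun s => nth 0%N s 0)).
  by rewrite nth_rev size_iota // !nth_iota ?subn1.
transitivity (staircase_count k' n); last first.
  by apply: eq_bigr => i _; rewrite addSn subn1.
rewrite -[n in RHS](size_iota 0) -(typed_fun_count _ sV f0 tf).
rewrite -(all_mchains_map (h := @word n) (r := r) (r' := fun v w =>
  f v \subset f w)); last by move=> v w _ _; rewrite rE.
apply: all_mchains_perm; apply: uniq_perm.
- by rewrite (map_inj_uniq (@word_inj n)) enum_uniq.
- exact: permutations_uniq.
move=> s; rewrite mem_permutations; apply/mapP/idP => [[v _ ->] | /word_surj[v <-]].
  exact: perm_word.
by exists v; rewrite ?mem_enum.
Qed.
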